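(* Let $X_1,\dots,X_n$ be independent random vectors in a separable Banach space $(\mathfrak{X},\|\cdot\|)$ (not necessarily 2-smooth). Let $Y:=\|X_1+\dots+X_n\|$, and suppose that $Y$ has a finite mean. Take any real $t>2$. For each $i\in\{1,\dots,n\}$, take any $x_i$ and $y_i$ in $\mathfrak{X}$. Then $$\mathsf{E}|Y-\mathsf{E}Y|^t\le C_t\,C_A^{(t)}\sum_{i=1}^n\mathsf{E}\|X_i-x_i\|^t+C_B^{(t)}\Big(\sum_{i=1}^n\mathsf{E}\|X_i-y_i\|^2\Big)^{t/2},$$ where the constants $C_t$, $C_A^{(t)}$, $C_B^{(t)}$ are those defined in the context (for any admissible choice of the functions $p,q$ and of the positive numbers $\lambda_j$ there). In particular, $C_3<1.316$ and $$\mathsf{E}|Y-\mathsf{E}Y|^3\le1.316\sum_{i=1}^n\mathsf{E}\|X_i-x_i\|^3+2\Big(\sum_{i=1}^n\mathsf{E}\|X_i-y_i\|^2\Big)^{3/2}.$$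
   Context: Constant $C_t$ (for $t>2$): $C_t:=R(t,b_t)$, where $b_t$ is the unique maximizer over $b\in[0,\frac12]$ of $$R(t,b):=\big(b^{t-1}+(1-b)^{t-1}\big)\big(b^{\frac1{t-1}}+(1-b)^{\frac1{t-1}}\big)^{t-1}.$$ Constants $C_A^{(t)},C_B^{(t)}$: let $m:=\lfloor t/2\rfloor$, let $\lambda_0,\dots,\lambda_{m-1}$ be any positive real numbers, and let $p(\cdot),q(\cdot)$ be any real-valued functions on $[2,\infty)$ such that $p(2)+q(2)\ge1$, $p(2)>0$, $q(2)>0$; $p(s)\ge1$ and $q(s)\ge1$ for all $s>2$; and $p(s)^{1/(3-s)}+q(s)^{1/(3-s)}\le1$ for all $s>3$. Put $$c_j^{(t)}:=q(t-2j)\prod_{k=0}^{j-1}\frac{(t-2k)(t-2k-1)\,p(t-2k)}2\quad(0\le j\le m-1),\qquad \tilde c_m^{(t)}:=\prod_{j=0}^{m-1}\frac{(t-2j)(t-2j-1)\,p(t-2j)}2,$$ $$C_A^{(t)}:=\sum_{j=0}^{m-1}c_j^{(t)}\,\frac{t-2j-2}{t-2}\,\frac1{\lambda_j^{2j}\,j!},\qquad C_B^{(t)}:=\tilde c_m^{(t)}\prod_{j=1}^m\frac1{t/2-m+j}+\sum_{j=0}^{m-1}c_j^{(t)}\,\frac{2j}{t-2}\,\frac{\lambda_j^{t-2j-2}}{j!}.$$ Empty sums are $0$ and empty products are $1$. *)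

(* Defs.v *)
From HB Require Import structures.
From mathcomp Require Import all_boot all_order all_algebra.
From mathcomp Require Import all_classical all_reals all_analysis.

Set Implicit Arguments.
Unset Strict Implicit.
Unset Printing Implicit Defensive.

Import Order.TTheory GRing.Theory Num.Theory.
Import numFieldNormedType.Exports.

Local Open Scope classical_set_scope.
Local Open Scope ring_scope.

Definition separable (E : topologicalType) : Prop :=
  exists D : set E, countable D /\ dense D.

Notation borel E := (g_sigma_algebraType (@open E)).

Definition random_vector d (T : measurableType d) (R : realType)
    (E : completeNormedModType R) (X : T -> E) : Prop :=
  measurable_fun [set: T] (X : T -> borel E).

Definition independent d (T : measurableType d) (R : realType)
    (P : probability T R) (E : completeNormedModType R) (n : nat)
    (X : 'I_n -> T -> E) : Prop :=
  forall (J : {set 'I_n}) (B : 'I_n -> set (borel E)),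
    (forall i, i \in J -> measurable (B i)) ->
    P (\bigcap_(i in [set` J]) (X i @^-1` B i)) =
    (\prod_(i in J) P (X i @^-1` B i))%E.

Section constants.
Context {R : realType}.
Implicit Types (t b : R) (p q : R -> R) (lam : nat -> R).

Definition Rfun t b : R :=
  (b `^ (t - 1) + (1 - b) `^ (t - 1)) *
  (b `^ (t - 1)^-1 + (1 - b) `^ (t - 1)^-1) `^ (t - 1).

Definition is_maximizer t b : Prop :=
  0 <= b <= 2^-1 /\
  forall b' : R, 0 <= b' <= 2^-1 -> Rfun t b' <= Rfun t b.

(* For [t > 2] the maximizer is unique; [0] is the default value of [xget]
   and is not reached, [Rfun t] being continuous on a compact interval. *)
Definition bmax t : R := xget 0 [set b | is_maximizer t b].

Definition Ct t : R := Rfun t (bmax t).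

(* [p] and [q] are functions on [2, +oo); only their values there matter. *)
Definition admissible p q : Prop :=
  [/\ 1 <= p 2 + q 2, 0 < p 2, 0 < q 2,
      (forall s : R, 2 < s -> 1 <= p s /\ 1 <= q s) &
      (forall s : R, 3 < s ->
         p s `^ (3 - s)^-1 + q s `^ (3 - s)^-1 <= 1)].

Definition mt t : nat := Num.truncn (t / 2).

Definition cfactor p t (k : nat) : R :=
  (t - (2 * k)%:R) * (t - (2 * k)%:R - 1) * p (t - (2 * k)%:R) / 2.

Definition cj p q t (j : nat) : R :=
  q (t - (2 * j)%:R) * \prod_(0 <= k < j) cfactor p t k.

Definition ctilde p t : R := \prod_(0 <= j < mt t) cfactor p t j.

Definition CA p q lam t : R :=
  \sum_(0 <= j < mt t)
    cj p q t j * ((t - (2 * j)%:R - 2) / (t - 2)) *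
    (lam j ^+ (2 * j) * j`!%:R)^-1.

Definition CB p q lam t : R :=
  ctilde p t * \prod_(1 <= j < (mt t).+1) (t / 2 - (mt t)%:R + j%:R)^-1 +
  \sum_(0 <= j < mt t)
    cj p q t j * ((2 * j)%:R / (t - 2)) *
    (lam j `^ (t - (2 * j)%:R - 2) / j`!%:R).

End constants.

(* Main.v *)
(* A Rosenthal-type martingale argument. Conditioning on the first [i] summands
   turns [Y - E Y] into a sum of martingale differences [xi_i]. The norm being
   1-Lipschitz, [xi_i] is conditionally the centering of a variable bounded by
   [|X_i - x_i|], for every choice of [x_i]; hence its conditional moment of
   order [t] is at most [Ct t] times [E |X_i - x_i|^t], by the optimal
   re-centering inequality, and its conditional variance is at most
   [E |X_i - y_i|^2]. A second order Taylor bound for [|u|^s] estimates the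
   moment of order [s] of the martingale by its moment of order [s - 2] and the
   moment of order [s] of the differences; iterating it [mt t] times from
   [s = t], and interpolating the intermediate moments of the differences
   between the orders [2] and [t], gives the constants.

   Neither conditional expectations nor product measures are needed: each [X_i]
   is rounded to the nearest of the first [k + 1] points of a dense sequence, so
   that all expectations are finite sums, and [k] tends to infinity. *)

Require Import Defs.
From HB Require Import structures.
From mathcomp Require Import all_boot all_order all_algebra.
From mathcomp Require Import all_classical all_reals all_analysis.
From mathcomp Require Import measurable_realfun.
From mathcomp Require Import ring lra.
Import Order.TTheory GRing.Theory Num.Theory.
Import numFieldNormedType.Exports.
Local Open Scope classical_set_scope.
Local Open Scope ring_scope.

Set Implicit Arguments.
Unset Strict Implicit.
Unset Printing Implicit Defensive.

(** * Inequalities for real powers *)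

Lemma cvg_norm_powR0 (R : realType) (r : R) :
  0 < r -> `|u| `^ r @[u --> (0 : R)] --> (0 : R).
Proof.
move=> r0; apply/cvgr0Pnorm_lt => e e0; near=> u.
rewrite ger0_norm ?powR_ge0//.
have -> : e = (e `^ r^-1) `^ r by rewrite -powRrM mulVf ?gt_eqF// powRr1// ltW.
apply: gt0_ltr_powR; rewrite ?nnegrE ?powR_ge0//.
near: u.
by apply: (@cvgr0_norm_lt _ _ _ _ _ (fun x : R => x)) => //; rewrite powR_gt0.
Unshelve. all: by end_near. Qed.

(** The function is the odd power of order [r + 1]. Away from [0] it is a plain power up to sign; at
    [0] its difference quotient is [|h|^r], which tends to [0]. *)
Lemma is_derive_mul_norm_powR (R : realType) (r x : R) : 0 < r ->
  is_derive x 1 (fun u => u * `|u| `^ r) ((r + 1) * `|x| `^ r).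
Proof.
move=> r0; have [x0|x0|->] := ltgtP x 0.
- apply: (@near_eq_is_derive _ _ _ (fun u => - ((- u) `^ (r + 1)))).
    near=> u; have u0 : u < 0 by near: u; exact: lt_nbhsl.
    rewrite ltr0_norm// -(mulr_powRB1 (p := r + 1)) ?addrK ?mulNr ?opprK//; lra.
  have x0' : 0 < - x by lra.
  have := is_derive1_comp (is_derive1_powR (r + 1) x0') (is_deriveNid x 1).
  move=> /is_deriveN; rewrite addrK ltr0_norm//.
  by rewrite /comp /= mulrN1 opprK.
- apply: (@near_eq_is_derive _ _ _ (fun u : R => u `^ (r + 1))).
    near=> u; have u0 : 0 < u by near: u; exact: lt_nbhsr.
    rewrite gtr0_norm// -(mulr_powRB1 (p := r + 1)) ?addrK//; lra.
  by have := is_derive1_powR (r + 1) x0; rewrite addrK gtr0_norm.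
rewrite normr0 powR0 ?gt_eqF// mulr0.
have H : h^-1 *: (((fun u => u * `|u| `^ r) \o shift 0) (h *: 1) - 0 * `|0 : R| `^ r)
    @[h --> (0:R)^'] --> (0 : R).
  have H0 : `|h| `^ r @[h --> (0:R)^'] --> (0 : R).
    by apply: cvg_within_filter; exact: cvg_norm_powR0.
  apply: (cvg_trans _ H0); apply: near_eq_cvg; near=> h.
  have h0 : h != 0 by near: h; exact: nbhs_dnbhs_neq.
  rewrite /= /shift /= addr0 mul0r subr0 /GRing.scale /= !mulr1.
  by rewrite mulrA mulVf// mul1r.
by split; [apply/cvg_ex; exists 0; exact: H|exact: cvg_lim H].
Unshelve. all: by end_near. Qed.

(** Young's inequality with the conjugate exponents [th^-1] and [(1 - th)^-1]; the end points, where
    one of them would be infinite, are direct. *)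
Lemma powR_amgm (R : realType) (x y th : R) :
  0 <= x -> 0 <= y -> 0 <= th <= 1 ->
  x `^ th * y `^ (1 - th) <= th * x + (1 - th) * y.
Proof.
move=> x0 y0 /andP[]; rewrite le_eqVlt => /predU1P[<- _|t0].
  by rewrite powRr0 !subr0 powRr1// !mul1r mul0r add0r.
rewrite le_eqVlt => /predU1P[->|t1].
  by rewrite subrr powRr0 powRr1// mul0r addr0 mulr1 mul1r.
have := @conjugate_powR R (x `^ th) (y `^ (1 - th)) th^-1 (1 - th)^-1.
rewrite -!powRrM !invrK !mulfV ?gt_eqF// ?subr_gt0// !powRr1//.
rewrite !powR_ge0 invr_gt0 t0 invr_gt0 subr_gt0 t1 => /(_ erefl erefl erefl erefl).
rewrite addrCA subrr addr0 => /(_ erefl) /le_trans; apply.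
by rewrite mulrC [X in _ + X]mulrC.
Qed.

(** The tangent of the convex power at [b], read off from AM-GM for [(b + d)^e] and [b^e] with
    weight [e^-1]; this covers [b = 0] as well. *)
Lemma powR_tangent (R : realType) (b d e : R) : 0 <= b -> 0 <= d -> 1 <= e ->
  b `^ e + e * d * b `^ (e - 1) <= (b + d) `^ e.
Proof.
move=> b0 d0 e1; have e0 : 0 < e by lra.
have th : 0 <= e^-1 <= 1 by rewrite invr_ge0 ltW//= invf_le1.
have := powR_amgm (powR_ge0 (b + d) e) (powR_ge0 b e) th.
rewrite -!powRrM mulfV ?gt_eqF// mulrBr mulr1 mulfV ?gt_eqF// powRr1 ?addr_ge0//.
rewrite mulrDl mulr_powRB1// => h.
have : e * (b `^ e + d * b `^ (e - 1)) <=
    e * (e^-1 * (b + d) `^ e + (1 - e^-1) * b `^ e) by rewrite ler_pM2l.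
rewrite [e * (_ * _ + _)]mulrDr !mulrA mulfV ?gt_eqF// mulrBr mulfV ?gt_eqF//; lra.
Qed.

(** A ratio [c / (a + b)] in [[0, 1]] is at most its power of order [r <= 1]; the cases [c = a] and
    [c = b] are added. *)
Lemma powR_subadditive (R : realType) (r a b : R) : 0 < r <= 1 ->
  0 <= a -> 0 <= b -> (a + b) `^ r <= a `^ r + b `^ r.
Proof.
move=> /andP[r0 r1] a0 b0.
have [ab0|ab0] := eqVneq (a + b) 0.
  by rewrite ab0 powR0 ?gt_eqF// addr_ge0// powR_ge0.
have abp : 0 < a + b by rewrite lt0r ab0 addr_ge0.
have key c : 0 <= c <= a + b -> c / (a + b) * (a + b) `^ r <= c `^ r.
  move=> /andP[]; rewrite le_eqVlt => /predU1P[<- _|c0 cab].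
    by rewrite !mul0r powR_ge0.
  have -> : c `^ r = (c / (a + b)) `^ r * (a + b) `^ r.
    by rewrite -powRM ?divr_ge0 ?ltW// mulfVK.
  rewrite ler_wpM2r ?powR_ge0// ger1_powR//.
  by rewrite divr_gt0//= ler_pdivrMr// mul1r.
have := lerD (key a _) (key b _).
rewrite -mulrDl -mulrDl mulfV// mul1r; apply; lra.
Qed.

(** For [s <= 3] the exponent is at most [1] and subadditivity suffices. Beyond, Hölder's inequality
    with weights [p^(1/(s-2))], [q^(1/(s-2))] leaves the dual sum [p^(1/(3-s)) + q^(1/(3-s))], which
    is at most [1]. *)
Lemma norm_powR_split (R : realType) (s p q a b : R) : 2 < s ->
  1 <= p -> 1 <= q ->
  (3 < s -> p `^ (3 - s)^-1 + q `^ (3 - s)^-1 <= 1) ->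
  `|a + b| `^ (s - 2) <= p * `|a| `^ (s - 2) + q * `|b| `^ (s - 2).
Proof.
move=> s2 p1 q1 pq.
have s20 : 0 < s - 2 by lra.
apply: (@le_trans _ _ ((`|a| + `|b|) `^ (s - 2))).
  by rewrite ge0_ler_powR ?nnegrE ?(ltW s20) ?addr_ge0 ?ler_normD.
have [s3|s3] := leP s 3.
  have r1 : 0 < s - 2 <= 1 by apply/andP; split; lra.
  apply: (le_trans (powR_subadditive r1 (normr_ge0 a) (normr_ge0 b))).
  by rewrite lerD// ler_peMl// powR_ge0.
set r := s - 2.
have r1 : 1 < r by rewrite /r; lra.
have r0 : 0 < r by lra.
have r10 : 0 < 1 - r^-1 by rewrite subr_gt0 invf_lt1.
have := @hoelder2 R (`|a| * p `^ r^-1) (`|b| * q `^ r^-1)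
  (p `^ (- r^-1)) (q `^ (- r^-1)) r (1 - r^-1)^-1.
rewrite !mulr_ge0 ?powR_ge0// r0 invr_gt0 r10 invrK addrCA subrr addr0.
move=> /(_ erefl erefl erefl erefl erefl erefl erefl).
have aux (x y : R) : 1 <= y -> x * y `^ r^-1 * y `^ (- r^-1) = x.
  move=> y1; rewrite -mulrA powRN mulfV ?mulr1// gt_eqF// powR_gt0//; lra.
rewrite !aux// !powRM ?powR_ge0// -!powRrM mulVf ?gt_eqF// !powRr1 ?(le_trans ler01)//.
have -> : - r^-1 * (1 - r^-1)^-1 = (3 - s)^-1.
  have -> : 3 - s = - (r * (1 - r^-1)).
    by rewrite mulrBr mulfV ?gt_eqF// /r; lra.
  by rewrite invrN invfM mulNr.
move=> h; rewrite !(mulrC _ (`|_| `^ _)).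
set M := (X in _ <= X); rewrite -/M in h.
have M0 : 0 <= M by rewrite addr_ge0// mulr_ge0 ?powR_ge0//; lra.
have h' : `|a| + `|b| <= M `^ r^-1.
  apply: (le_trans h); rewrite ler_piMr ?powR_ge0//.
  rewrite -[leRHS](_ : 1 `^ (1 - r^-1) = 1); last by rewrite powR1.
  by rewrite ge0_ler_powR ?nnegrE ?(ltW r10) ?addr_ge0 ?powR_ge0// pq.
have -> : M = (M `^ r^-1) `^ r by rewrite -powRrM mulVf ?gt_eqF// powRr1.
by rewrite ge0_ler_powR ?nnegrE ?(ltW r0) ?addr_ge0 ?powR_ge0.
Qed.

Lemma ge0_is_derive_ndecr (R : realType) (f df : R -> R) (x : R) :
  (forall u : R, is_derive u 1 f (df u)) -> (forall u, 0 <= u -> 0 <= df u) ->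
  0 <= x -> f 0 <= f x.
Proof.
move=> fdf df0 x0; have [|c] := MVT_segment x0 (fun u _ => fdf u).
  apply: derivable_within_continuous => u _; by case: (fdf u).
rewrite in_itv/= => /andP[c0 _] E; rewrite -subr_ge0 E subr0.
by rewrite mulr_ge0// df0// (le_trans _ c0).
Qed.

(** For [s > 2] the splitting of [|a + u|^(s - 2)] is integrated twice in [u] from [0], after a
    change of signs that makes [x] nonnegative. At [s = 2] the bound is the condition
    [p 2 + q 2 >= 1]. *)
Lemma norm_powR_taylor (R : realType) (p q : R -> R) (s a x : R) :
  admissible p q -> 2 <= s ->
  `|a + x| `^ s <= `|a| `^ s + s * (a * `|a| `^ (s - 2)) * x +
    s * (s - 1) * p s / 2 * `|a| `^ (s - 2) * x ^+ 2 + q s * `|x| `^ s.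
Proof.
case=> pq2 p2 q2 pq1 pq3.
rewrite le_eqVlt => /predU1P[<-|s2].
  rewrite subrr !powRr0 !(powR_mulrn 2)// !real_normK ?num_real//.
  rewrite !mulr1.
  have : 0 <= (p 2 + q 2 - 1) * x ^+ 2 by rewrite mulr_ge0 ?sqr_ge0//; lra.
  have -> : (a + x) ^+ 2 = a ^+ 2 + 2 * a * x + x ^+ 2 by ring.
  have -> : 2 * (2 - 1) * p 2 / 2 * x ^+ 2 = p 2 * x ^+ 2 by field.
  rewrite mulrBl mulrDl; lra.
have [p1 q1] := pq1 _ s2.
wlog x0 : a x / 0 <= x => [H|].
  have [|x0] := leP 0 x; first exact: H.
  have := H (- a) (- x); rewrite oppr_ge0 ltW// => /(_ erefl).
  by rewrite -opprD !normrN sqrrN mulrN !mulNr mulrN mulNr opprK.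
set r := s - 2; have r0 : 0 < r by rewrite /r; lra.
have normE (u : R) : `|u| `^ s = u * (u * `|u| `^ r).
  rewrite mulrA -expr2 -real_normK ?num_real// expr2 -mulrA.
  have -> : r = s - 1 - 1 by rewrite /r; lra.
  by rewrite !mulr_powRB1//; lra.
rewrite !normE; set S := fun u : R => u * `|u| `^ r.
have dS (u : R) : is_derive u 1 S ((r + 1) * `|u| `^ r) by exact: is_derive_mul_norm_powR.
have dM (u : R) : is_derive u 1 (fun u => u * S u) (s * S u).
  apply: is_derive_eq; rewrite /S /GRing.scale /= /r; ring.
have dadd (u : R) : is_derive u 1 (fun u : R => a + u) 1.
  by have := is_deriveD (is_derive_cst a u 1) (is_derive_id u 1); rewrite add0r.
have dSa (u : R) : is_derive u 1 (fun u => S (a + u)) ((r + 1) * `|a + u| `^ r).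
  by have := is_derive1_comp (dS (a + u)) (dadd u); rewrite mulr1.
have dMa (u : R) : is_derive u 1 (fun u => (a + u) * S (a + u)) (s * S (a + u)).
  by have := is_derive1_comp (dM (a + u)) (dadd u); rewrite mulr1.
(* Up to the factor [s], [Psi] is the derivative of the final gap [Phi]; its own derivative is
   [s - 1] times the gap in [norm_powR_split], and both functions vanish at [0]. *)
pose Psi u := S a + (s - 1) * p s * `|a| `^ r * u + q s * S u - S (a + u).
have dPsi (u : R) : is_derive u 1 Psi
    ((s - 1) * (p s * `|a| `^ r + q s * `|u| `^ r - `|a + u| `^ r)).
  by apply: is_derive_eq; rewrite /GRing.scale /= /r; ring.
have Psi0 u : 0 <= u -> 0 <= Psi u.
  move=> u0; have -> : 0 = Psi 0 by rewrite /Psi /S addr0 mul0r !mulr0 !addr0 subrr.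
  apply: (ge0_is_derive_ndecr dPsi) => // v v0; apply: mulr_ge0; first lra.
  by rewrite subr_ge0 norm_powR_split//; exact: pq3.
pose Phi u := a * S a + s * S a * u + s * (s - 1) * p s / 2 * `|a| `^ r * u ^+ 2
  + q s * (u * S u) - (a + u) * S (a + u).
have dPhi (u : R) : is_derive u 1 Phi (s * Psi u).
  by apply: is_derive_eq; rewrite /Psi /GRing.scale /=; field.
have : Phi 0 <= Phi x.
  apply: (ge0_is_derive_ndecr dPhi) => // u u0; rewrite mulr_ge0 ?Psi0//; lra.
have -> : Phi 0 = 0 by rewrite /Phi /S addr0 expr2 !mul0r !mulr0 !addr0 subrr.
by rewrite subr_ge0.
Qed.

(** * Optimal re-centering *)

Lemma continuous_norm_powR (R : realType) (r : R) :
  0 < r -> continuous (fun u : R => `|u| `^ r).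
Proof.
move=> r0 x; have [->|x0] := eqVneq x 0.
  by rewrite /continuous_at normr0 powR0 ?gt_eqF//; exact: cvg_norm_powR0.
have nx0 : 0 < `|x| by rewrite normr_gt0.
apply: (@continuous_comp _ _ _ (fun u : R => `|u|) (fun u : R => u `^ r)).
  exact: norm_continuous.
by apply/differentiable_continuous/derivable1_diffP; case: (is_derive1_powR r nx0).
Qed.

(** Hölder's inequality gives the least value of [v |z1|^t + u |z2|^t] under the constraint on
    [|z1| + |z2|]; multiplying the dual factor by [u v] turns it into the second factor of
    [Rfun]. *)
Lemma two_point_hoelder (R : realType) (t u v z1 z2 : R) :
  1 < t -> 0 < u -> 0 < v -> v + u <= `|z1| + `|z2| ->
  u * v * (v + u) `^ t <= (v * `|z1| `^ t + u * `|z2| `^ t) *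
    (v `^ (t - 1)^-1 + u `^ (t - 1)^-1) `^ (t - 1).
Proof.
move=> t1 u0 v0 le12; set k := t - 1.
have k0 : 0 < k by rewrite subr_gt0.
have t0 : 0 < t by exact: lt_trans t1.
set M := _ + _ * _ `^ t.
have M0 : 0 <= M by rewrite addr_ge0// mulr_ge0 ?powR_ge0 ?ltW.
have D0 : 0 < v + u by rewrite addr_gt0.
pose N := v `^ (- k^-1) + u `^ (- k^-1).
have N0 : 0 <= N by rewrite addr_ge0 ?powR_ge0.
have ek : (1 - t^-1) * t = k by rewrite mulrBl mulVf ?gt_eqF// mul1r.
have r10 : 0 < 1 - t^-1 by rewrite -(pmulr_lgt0 _ t0) ek.
have uvN : u * v * N `^ k = (v `^ k^-1 + u `^ k^-1) `^ k.
  have inv (x : R) : 0 < x -> x = (x `^ k^-1) `^ k.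
    by move=> x0; rewrite -powRrM mulVf ?gt_eqF// powRr1// ltW.
  rewrite {1}(inv u u0) {1}(inv v v0) -!powRM ?N0 ?mulr_ge0 ?powR_ge0 ?ltW//.
  congr (_ `^ _); rewrite /N !powRN.
  rewrite (powRM _ (ltW u0) (ltW v0)).
  by field; rewrite !gt_eqF ?powR_gt0.
rewrite -uvN mulrCA ler_pM2l ?mulr_gt0//.
have := @hoelder2 R (v `^ t^-1 * `|z1|) (u `^ t^-1 * `|z2|)
  (v `^ (- t^-1)) (u `^ (- t^-1)) t (1 - t^-1)^-1.
rewrite !mulr_ge0 ?powR_ge0// t0 invr_gt0 r10 invrK addrCA subrr addr0.
move=> /(_ erefl erefl erefl erefl erefl erefl erefl).
have cancel (x y : R) : 0 < x -> x `^ t^-1 * y * x `^ (- t^-1) = y.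
  by move=> x0; rewrite mulrAC powRN mulfV ?mul1r// gt_eqF// powR_gt0.
rewrite (cancel v `|z1| v0) (cancel u `|z2| u0).
have cancel2 (x y : R) : 0 < x -> (x `^ t^-1 * `|y|) `^ t = x * `|y| `^ t.
  move=> x0; rewrite powRM ?powR_ge0// -powRrM mulVf ?(lt0r_neq0 t0)//.
  by rewrite (powRr1 (ltW x0)).
rewrite (cancel2 v z1 v0) (cancel2 u z2 u0) -!(powRrM _ (- t^-1)).
have -> : - t^-1 * (1 - t^-1)^-1 = - k^-1 by rewrite mulNr -invfM mulrC ek.
rewrite -/M -/N => h.
have -> : M * N `^ k = (M `^ t^-1 * N `^ (1 - t^-1)) `^ t.
  rewrite powRM ?powR_ge0// -!powRrM ek mulVf ?(lt0r_neq0 t0)//.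
  by rewrite (powRr1 M0).
rewrite ge0_ler_powR ?nnegrE ?(ltW t0) ?mulr_ge0 ?powR_ge0 ?(ltW D0)//.
exact: le_trans h.
Qed.

Lemma Rfun_homogeneous (R : realType) (t u v : R) : 1 < t -> 0 < u -> 0 < v ->
  Rfun t (v / (v + u)) * (v + u) `^ t =
  (v `^ (t - 1) + u `^ (t - 1)) *
  (v `^ (t - 1)^-1 + u `^ (t - 1)^-1) `^ (t - 1).
Proof.
move=> t1 u0 v0; have D0 : 0 < v + u by rewrite addr_gt0.
have k0 : 0 < t - 1 by rewrite subr_gt0.
rewrite /Rfun -(mulr_powRB1 (ltW D0) (lt_trans ltr01 t1)).
move: k0; set k := t - 1 => k0.
have -> : 1 - v / (v + u) = u / (v + u) by field; rewrite gt_eqF.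
rewrite !powRM ?invr_ge0 ?ltW// -!mulrDl powRM ?addr_ge0 ?powR_ge0//.
rewrite -powRrM mulVf ?gt_eqF// powRr1 ?invr_ge0 ?ltW//.
have -> : (v + u)^-1 `^ k = ((v + u) `^ k)^-1.
  by rewrite -(powR_inv1 (ltW D0)) -powRrM mulN1r powRN.
by field; rewrite !gt_eqF ?powR_gt0.
Qed.

Section recentering.
Variables (R : realType) (t : R).
Hypothesis t2 : 2 < t.

Lemma is_maximizer_bmax : is_maximizer t (bmax t).
Proof.
have t1 : 0 < t - 1 by move: t2; lra.
have t1' : 0 < (t - 1)^-1 by rewrite invr_gt0.
(* The absolute values make [g] continuous on the whole line and change nothing on [[0, 1/2]]. *)
pose g (b : R) := (`|b| `^ (t - 1) + `|1 - b| `^ (t - 1)) *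
    `|(`|b| `^ (t - 1)^-1 + `|1 - b| `^ (t - 1)^-1)| `^ (t - 1).
have gE b : 0 <= b <= 2^-1 -> Rfun t b = g b.
  move=> /andP[b0 b1]; have b1' : 0 <= 1 - b by lra.
  by rewrite /Rfun /g !ger0_norm// addr_ge0 ?powR_ge0.
have cpow (r : R) (f : R -> R) x : 0 < r -> {for x, continuous f} ->
    {for x, continuous (fun b => `|f b| `^ r)}.
  move=> r0 cf; apply: (@continuous_comp _ _ _ f (fun u : R => `|u| `^ r)) => //.
  exact: continuous_norm_powR.
have c1 (x : R) : {for x, continuous (fun b : R => b)} by exact: cvg_id.
have c2 (x : R) : {for x, continuous (fun b : R => 1 - b)}.
  by apply: cvgB; [exact: cvg_cst|exact: cvg_id].
have cg : continuous g.
  move=> x.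
  have cD r : 0 < r ->
      {for x, continuous (fun b : R => `|b| `^ r + `|1 - b| `^ r)}.
    by move=> r0; exact: (cvgD (cpow _ _ _ r0 (c1 x)) (cpow _ _ _ r0 (c2 x))).
  exact: (cvgM (cD _ t1) (cpow _ _ _ t1 (cD _ t1'))).
have h : 0 <= 2^-1 :> R by lra.
have [c] := EVT_max h (continuous_subspaceT cg).
rewrite in_itv/= => cI cmax.
apply: (@xgetPex _ 0 [set b | is_maximizer t b]); exists c.
split; first exact: cI.
by move=> b bI; rewrite (gE _ bI) (gE _ cI); apply: cmax; rewrite in_itv.
Qed.

Lemma Rfun_sym (b : R) : Rfun t (1 - b) = Rfun t b.
Proof.
by rewrite /Rfun subKr [b `^ (t - 1) + _]addrC [b `^ (t - 1)^-1 + _]addrC.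
Qed.

Lemma Rfun_le_Ct (b : R) : 0 <= b <= 1 -> Rfun t b <= Ct t.
Proof.
have [_ bmaxP] := is_maximizer_bmax.
move=> /andP[b0 b1]; have [b2|b2] := leP b 2^-1.
  by apply: bmaxP; rewrite b0.
by rewrite -Rfun_sym; apply: bmaxP; apply/andP; lra.
Qed.

(** The value of [Rfun t] at [0] is [1]. *)
Lemma Ct_ge1 : 1 <= Ct t.
Proof.
have t1 : 0 < t - 1 by move: t2; lra.
apply: le_trans (Rfun_le_Ct (b := 0) _); last by rewrite lexx ler01.
by rewrite /Rfun subr0 !powR0 ?gt_eqF ?invr_gt0// !powR1 !add0r powR1 mulr1.
Qed.

(** Re-centering for the law with mean [a] carried by [z1] and [z2], its weights being proportional
    to [z2 - a] and [a - z1]. The constant is [Rfun t] at the weight of [z1]. *)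
Lemma two_point_recentering (a z1 z2 : R) : z1 < a -> a < z2 ->
  (z2 - a) * `|z1 - a| `^ t + (a - z1) * `|z2 - a| `^ t <=
  Ct t * ((z2 - a) * `|z1| `^ t + (a - z1) * `|z2| `^ t).
Proof.
rewrite -subr_gt0 -[a < z2]subr_gt0 distrC => u0 v0.
rewrite (gtr0_norm u0) (gtr0_norm v0).
have le12 : z2 - a + (a - z1) <= `|z1| + `|z2|.
  by rewrite addrA subrK (le_trans (ler_norm _))// (addrC `|z1|) ler_normB.
move: u0 v0 le12; set u := a - z1; set v := z2 - a => u0 v0 le12.
have t1 : 1 < t by apply: lt_trans t2; rewrite ltr1n.
have t0 : 0 < t by exact: lt_trans t1.
have D0 : 0 < v + u by rewrite addr_gt0.
have vI : 0 <= v / (v + u) <= 1.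
  by rewrite divr_ge0 ?(ltW v0) ?(ltW D0)//= ler_pdivrMr// mul1r lerDl ltW.
move: (Rfun_le_Ct vI); move: (Ct t) => C.
rewrite -(ler_pM2r (powR_gt0 t D0)) (Rfun_homogeneous t1 u0 v0).
have := two_point_hoelder t1 u0 v0 le12.
set M := v * _ + _; set L := _ `^ (t - 1) => HM HC.
have M0 : 0 <= M by rewrite addr_ge0// mulr_ge0 ?powR_ge0 ?ltW.
rewrite -(ler_pM2r (powR_gt0 t D0)).
have -> : (v * u `^ t + u * v `^ t) * (v + u) `^ t =
    u * v * (v + u) `^ t * (v `^ (t - 1) + u `^ (t - 1)).
  by rewrite -(mulr_powRB1 (ltW v0) t0) -(mulr_powRB1 (ltW u0) t0); ring.
apply: le_trans (ler_wpM2r _ HM) _; first by rewrite addr_ge0 ?powR_ge0.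
rewrite -(mulrA M) (mulrC L) (mulrC C) -(mulrA M).
by rewrite ler_wpM2l.
Qed.

(* The two-point inequality says that the slopes of [C |z|^t - |z - a|^t] to the
   right of [a] dominate, up to sign, those to the left, so that a Lagrange
   multiplier for the constraint [E z = a] fits between them. *)
Lemma recentering_multiplier (a : R) : exists kappa : R, forall z : R,
  `|z - a| `^ t <= Ct t * `|z| `^ t + kappa * (z - a).
Proof.
pose g z := Ct t * `|z| `^ t - `|z - a| `^ t.
pose S := [set - g z / (z - a) | z in [set z | a < z]].
have ub z1 : z1 < a -> ubound S (g z1 / (a - z1)).
  move=> z1a _ [z2 /= az2 <-]; rewrite ler_pdivrMr ?subr_gt0//.
  rewrite mulrAC ler_pdivlMr ?subr_gt0//.
  by have := two_point_recentering z1a az2; rewrite /g; nra.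
have S0 : S !=set0.
  by exists (- g (a + 1) / (a + 1 - a)); exists (a + 1) => //=; lra.
have hS : has_sup S.
  by split=> //; exists (g (a - 1) / (a - (a - 1))); apply: ub; lra.
exists (sup S) => z; suff : 0 <= g z + sup S * (z - a) by rewrite /g; lra.
have [za|az|->] := ltgtP z a.
- have /(sup_le_ub S0) := ub _ za; rewrite ler_pdivlMr ?subr_gt0//; nra.
- have : - g z / (z - a) <= sup S by apply: ub_le_sup; [case: hS|exists z].
  by rewrite ler_pdivrMr ?subr_gt0//; nra.
- rewrite /g !subrr normr0 powR0 ?gt_eqF//; last by move: t2; lra.
  by rewrite subr0 mulr0 addr0 mulr_ge0 ?powR_ge0// (le_trans ler01)// Ct_ge1.
Qed.

(** The pointwise bound with multiplier is averaged over [w]; its linear term vanishes because [a]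
    is the mean. *)
Lemma recentering (K : finType) (w z : K -> R) :
  (forall k, 0 <= w k) -> \sum_k w k = 1 ->
  \sum_k w k * `|z k - \sum_l w l * z l| `^ t <= Ct t * \sum_k w k * `|z k| `^ t.
Proof.
move=> w0 w1; pose a := \sum_l w l * z l; rewrite -/a.
have [kappa h] := recentering_multiplier a.
apply: (@le_trans _ _ (\sum_k w k * (Ct t * `|z k| `^ t + kappa * (z k - a)))).
  by apply: ler_sum => k _; apply: (ler_wpM2l (w0 k)); exact: h.
rewrite le_eqVlt; apply/orP; left; apply/eqP.
rewrite (eq_bigr (fun k => Ct t * (w k * `|z k| `^ t) +
    (kappa * (w k * z k) - kappa * a * w k))); last by move=> k _; ring.
by rewrite big_split/= sumrB -!mulr_sumr w1 mulr1 -/a subrr addr0.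
Qed.
End recentering.

Lemma variance_le (R : realType) (K : finType) (w z : K -> R) (c : R) :
  \sum_k w k = 1 ->
  \sum_k w k * (z k - \sum_l w l * z l) ^+ 2 <= \sum_k w k * (z k - c) ^+ 2.
Proof.
move=> w1; pose a := \sum_l w l * z l; rewrite -/a.
rewrite -subr_ge0 -sumrB.
rewrite (eq_bigr (fun k => (2 * (a - c)) * (w k * z k) -
   (a ^+ 2 - c ^+ 2) * w k)); last by move=> k _; ring.
rewrite sumrB -!mulr_sumr w1 -/a.
by rewrite (_ : _ - _ = (a - c) ^+ 2) ?sqr_ge0//; ring.
Qed.

(* The maximum is attained near [s = 45 / 164]. *)
Lemma cubic_lt (R : realType) (s : R) : 0 <= s ->
  (1 - 2 * s ^+ 2) * (1 + 2 * s) < 1316 / 1000.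
Proof.
move=> s0; rewrite -subr_gt0.
(* With [c = 45 / 164], the product [4 (s - c)^2 (s + 1/2 + 2 c)] has the right cubic and quadratic
   terms; [7 / 6724 * s] corrects for [c] not being exactly critical. *)
have -> : 1316 / 1000 - (1 - 2 * s ^+ 2) * (1 + 2 * s) =
  4 * ((s - 45 / 164) ^+ 2 * (s + (1 / 2 + 45 / 82))) + 7 / 6724 * s +
  (316 / 1000 - (4 * (45 / 164) ^+ 2 * (1 / 2 + 45 / 82))) by field.
have c0 : 0 < 316 / 1000 - (4 * (45 / 164) ^+ 2 * (1 / 2 + 45 / 82)) :> R by lra.
apply: ltr_wpDl c0; apply: addr_ge0; last by rewrite mulr_ge0 ?s0 ?divr_ge0 ?ler0n.
by apply: mulr_ge0; [lra|apply: mulr_ge0; [exact: sqr_ge0|lra]].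
Qed.

Lemma Ct3_lt (R : realType) : Ct (3 : R) < 1316 / 1000.
Proof.
have t2 : 2 < 3 :> R by lra.
have [/andP[b0 b1] _] := is_maximizer_bmax t2; rewrite /Ct.
move: (bmax 3) b0 b1 => b b0 b1; rewrite /Rfun.
have -> : 3 - 1 = 2 :> R by lra.
have b1' : 0 <= 1 - b by lra.
rewrite !powR12_sqrt// !(powR_mulrn 2) ?b1' ?addr_ge0 ?sqrtr_ge0//.
have := sqr_sqrtr b0; have := sqr_sqrtr b1'.
have := sqrtr_ge0 b; have := sqrtr_ge0 (1 - b).
move: (Num.sqrt b) (Num.sqrt (1 - b)) => x y y0 x0 Ey Ex.
(* At [t = 3] everything depends on [s], the square root of [b (1 - b)], alone. *)
pose s := x * y; have s0 : 0 <= s by rewrite mulr_ge0.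
have -> : (b ^+ 2 + (1 - b) ^+ 2) * (x + y) ^+ 2 = (1 - 2 * s ^+ 2) * (1 + 2 * s).
  have h1 : (x + y) ^+ 2 = 1 + 2 * s by rewrite /s sqrrD Ex Ey mulr_natl; ring.
  have h2 : s ^+ 2 = b * (1 - b) by rewrite /s exprMn Ex Ey.
  by rewrite h1 h2; ring.
exact: cubic_lt.
Qed.

(** * Random walks with finitely many steps *)

Section steps.
Variables (R : realType) (E : completeNormedModType R) (K : finType) (I : Type).
Variables (v : K -> E) (mu : I -> K -> R).
Implicit Types (F G : E -> R) (r : seq I) (i : I).

(* [walk r F] is [E F(S)] for [S] a sum of independent steps, one for each [i] in
   [r], the step [i] being equal to [v k] with probability [mu i k]; the head of
   [r] is the last step, so that [step] is the conditional expectation given the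
   previous ones. *)
Definition step i F : E -> R := fun s => \sum_k mu i k * F (s + v k).

Fixpoint walk r F : R := if r is i :: r' then walk r' (step i F) else F 0.

Hypothesis mu0 : forall i k, 0 <= mu i k.
Hypothesis mu1 : forall i, \sum_k mu i k = 1.

Lemma ler_step i F G s : (forall s, F s <= G s) -> step i F s <= step i G s.
Proof. by move=> FG; apply: ler_sum => k _; rewrite ler_wpM2l. Qed.

Lemma ler_walk r F G : (forall s, F s <= G s) -> walk r F <= walk r G.
Proof.
elim: r F G => [|i r IH] F G FG /=; first exact: FG.
by apply: IH => s; exact: ler_step.
Qed.

Lemma walkD r F G : walk r (fun s => F s + G s) = walk r F + walk r G.
Proof.
elim: r F G => [//|i r IH] F G /=; rewrite -IH; congr walk; apply/funext => s.
by rewrite /step -big_split/=; apply: eq_bigr => k _; rewrite mulrDr.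
Qed.

Lemma walkZ r c F : walk r (fun s => c * F s) = c * walk r F.
Proof.
elim: r F => [//|i r IH] F /=; rewrite -IH; congr walk; apply/funext => s.
by rewrite /step mulr_sumr; apply: eq_bigr => k _; rewrite mulrCA.
Qed.

Lemma walk_cst r c : walk r (fun=> c) = c.
Proof.
elim: r => [//|i r IH] /=; rewrite -[RHS]IH; congr walk; apply/funext => s.
by rewrite /step -mulr_suml mu1 mul1r.
Qed.

(** Jensen's inequality for a concave power: AM-GM against a constant [c >= B], [c > 0], gives the
    bound [c^e]. When [B = 0], arbitrarily small [c] are used. *)
Lemma walk_powR_le r G (e B : R) : (forall s, 0 <= G s) -> walk r G <= B ->
  0 <= e <= 1 -> walk r (fun s => G s `^ e) <= B `^ e.
Proof.
move=> G0 GB e01; have /andP[e0 e1] := e01.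
have B0 : 0 <= B by apply: le_trans GB; rewrite -(walk_cst r 0) ler_walk.
set N := walk r _.
have key c : 0 < c -> B <= c -> N <= c `^ e.
  move=> c0 Bc; have cp : 0 < c `^ (1 - e) by rewrite powR_gt0.
  rewrite -(ler_pM2l cp) -powRD; last by rewrite (gt_eqF c0) implybT.
  rewrite subrK powRr1 ?(ltW c0)// -walkZ.
  apply: (@le_trans _ _ (walk r (fun s => e * G s + (1 - e) * c))).
    by apply: ler_walk => s; rewrite mulrC powR_amgm// ltW.
  rewrite walkD walkZ walk_cst.
  have : e * walk r G <= e * c by rewrite ler_wpM2l// (le_trans GB).
  lra.
have [B_gt0|] := ltP 0 B; first exact: key.
move=> B_le0; have {}B0 : B = 0 by apply/eqP; rewrite eq_le B_le0.
have [ez|en0] := eqVneq e 0.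
  rewrite /N ez powRr0 (_ : (fun s => _) = fun=> 1) ?walk_cst//.
  by apply/funext => s; rewrite powRr0.
have ep : 0 < e by rewrite lt0r en0.
rewrite B0 powR0// leNgt; apply/negP => N0.
have N2 : 0 < N / 2 by rewrite divr_gt0.
have := key ((N / 2) `^ e^-1) (powR_gt0 _ N2).
rewrite B0 powR_ge0 => /(_ erefl).
rewrite -powRrM mulVf// (powRr1 (ltW N2)); lra.
Qed.

Definition nonexpansive F := forall s s', `|F s - F s'| <= `|s - s'|.

(** Averaging over a step keeps the Lipschitz constant [1], so all the successive conditional
    expectations of the norm are handled alike. *)
Lemma nonexpansive_step i F : nonexpansive F -> nonexpansive (step i F).
Proof.
move=> F1 s s'; rewrite /step -sumrB; apply: le_trans (ler_norm_sum _ _ _) _.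
apply: (@le_trans _ _ (\sum_k mu i k * `|s - s'|)).
  apply: ler_sum => k _; rewrite -mulrBr normrM ger0_norm// ler_wpM2l//.
  by apply: le_trans (F1 _ _) _; rewrite opprD addrACA subrr addr0.
by rewrite -mulr_suml mu1 mul1r.
Qed.

(** The martingale difference produced by step [i] from position [s]. *)
Definition incr i F s k := F (s + v k) - step i F s.

Lemma sum_incr i F s : \sum_k mu i k * incr i F s k = 0.
Proof.
rewrite (eq_bigr _ (fun k _ => mulrBr _ _ _)) sumrB.
by rewrite -mulr_suml mu1 mul1r subrr.
Qed.

(** The variance is at most the second moment about [F (s + y)], and [F] is 1-Lipschitz. *)
Lemma sum_incr_sqr i F s (y : E) : nonexpansive F ->
  \sum_k mu i k * incr i F s k ^+ 2 <= \sum_k mu i k * `|v k - y| ^+ 2.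
Proof.
move=> F1; apply: le_trans (variance_le (fun k => F (s + v k)) (F (s + y)) (mu1 i)) _.
apply: ler_sum => k _; rewrite ler_wpM2l// -real_normK ?num_real//.
by rewrite lerXn2r ?nnegrE// (le_trans (F1 _ _))// opprD addrACA subrr add0r.
Qed.

(** Centering [F (s + v k) - F (s + x)] yields the increment, and this variable is at most
    [|v k - x|] in absolute value. *)
Lemma sum_incr_powR i F s (x : E) (t : R) : 2 < t -> nonexpansive F ->
  \sum_k mu i k * `|incr i F s k| `^ t <=
  Ct t * \sum_k mu i k * `|v k - x| `^ t.
Proof.
move=> t2 F1.
have := recentering t2 (fun k => F (s + v k) - F (s + x)) (mu0 i) (mu1 i).
rewrite (eq_bigr (fun k => mu i k * `|incr i F s k| `^ t)); last first.
  move=> k _; rewrite /incr; congr (_ * `|_| `^ _).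
  rewrite (eq_bigr _ (fun k _ => mulrBr _ _ _)) sumrB -mulr_suml mu1 mul1r.
  by rewrite /step; ring.
move=> /le_trans; apply; rewrite ler_wpM2l ?(le_trans ler01 (Ct_ge1 t2))//.
apply: ler_sum => k _; rewrite ler_wpM2l// ge0_ler_powR ?nnegrE//; first lra.
by rewrite (le_trans (F1 _ _))// opprD addrACA subrr add0r.
Qed.

End steps.

(** * The iterated recursion *)

Section iterated_bound.
Variables (R : realType) (m : nat) (e0 : R) (Kf qf : nat -> R).
Hypothesis e00 : 0 <= e0.
Hypothesis Kf0 : forall j, (j < m)%N -> 0 <= Kf j.
Hypothesis qf0 : forall j, (j < m)%N -> 0 <= qf j.

(* An upper solution of the recursion [N_j(i+1) <= N_j(i) + Kf_j b_i N_(j+1)(i)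
   + qf_j rho_j(i)], [B] and [Rl] being the running sums of the [b_i] and of the
   [rho_j(i)]; [e0] is the exponent left after [m] reductions. *)
Definition iterated_bound (Rl : nat -> R) (B : R) (j : nat) : R :=
  \sum_(j <= l < m) (\prod_(j <= k < l) Kf k) * qf l *
     (B ^+ (l - j) / (l - j)`!%:R) * Rl l +
  (\prod_(j <= k < m) Kf k) * B `^ (e0 + (m - j)%:R) *
     \prod_(1 <= k < (m - j).+1) (e0 + k%:R)^-1.

Lemma prod_Kf_ge0 j l : (l <= m)%N -> 0 <= \prod_(j <= k < l) Kf k.
Proof.
move=> lm; rewrite big_nat_cond; apply: prodr_ge0 => k.
by rewrite andbT => /andP[_ kl]; rewrite Kf0// (leq_trans kl).
Qed.

(** Discrete form of the fact that [B^(n+1) / (n+1)!] has derivative [B^n / n!]: the tangent bound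
    divided by [(n+1)!]. *)
Lemma exp_fact_step (B b : R) n : 0 <= B -> 0 <= b ->
  B ^+ n.+1 / n.+1`!%:R + b * (B ^+ n / n`!%:R) <= (B + b) ^+ n.+1 / n.+1`!%:R.
Proof.
move=> B0 b0.
have := powR_tangent (e := n.+1%:R) B0 b0; rewrite ler1n => /(_ isT).
have -> : n.+1%:R - 1 = n%:R :> R by rewrite -natr1 addrK.
rewrite !powR_mulrn ?addr_ge0// => h.
have n0 : 0 < n.+1`!%:R :> R by rewrite ltr0n fact_gt0.
rewrite ler_pdivlMr// mulrDl mulfVK ?gt_eqF//; apply: le_trans h.
rewrite lerD2l factS natrM le_eqVlt; apply/orP; left; apply/eqP.
by field; rewrite pnatr_eq0 -lt0n fact_gt0.
Qed.

Lemma iterated_bound_ge0 Rl B j : 0 <= B ->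
  (forall l, (l < m)%N -> 0 <= Rl l) -> 0 <= iterated_bound Rl B j.
Proof.
move=> B0 Rl0; rewrite addr_ge0//.
  rewrite big_nat_cond sumr_ge0// => l; rewrite andbT => /andP[_ lm].
  by rewrite !mulr_ge0 ?qf0 ?Rl0 ?prod_Kf_ge0 ?(ltnW lm) ?exprn_ge0 ?invr_ge0.
rewrite !mulr_ge0 ?prod_Kf_ge0 ?powR_ge0// prodr_ge0// => k _.
by rewrite invr_ge0 addr_ge0.
Qed.

Lemma iterated_bound_m Rl B : iterated_bound Rl B m = B `^ e0.
Proof.
by rewrite /iterated_bound subnn !big_geq// add0r mul1r mulr1 addr0.
Qed.

Lemma iterated_bound_step Rl rho B b j : (j < m)%N -> 0 <= B -> 0 <= b ->
  (forall l, (l < m)%N -> 0 <= Rl l) -> (forall l, (l < m)%N -> 0 <= rho l) ->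
  iterated_bound Rl B j + Kf j * b * iterated_bound Rl B j.+1 + qf j * rho j <=
  iterated_bound (fun l => rho l + Rl l) (b + B) j.
Proof.
move=> jm B0 b0 Rl0 rho0; rewrite /iterated_bound.
(* The term [l = j] is split off: its growth is exactly [qf j * rho j]. *)
have TE Rl' B' : \sum_(j <= l < m) (\prod_(j <= k < l) Kf k) * qf l *
     (B' ^+ (l - j) / (l - j)`!%:R) * Rl' l = qf j * Rl' j +
   \sum_(j.+1 <= l < m) (\prod_(j <= k < l) Kf k) * qf l *
     (B' ^+ (l - j) / (l - j)`!%:R) * Rl' l.
  rewrite [LHS]big_ltn// subnn (big_geq (leqnn j)) fact0 !expr0 divr1.
  by rewrite mulr1 mul1r.
rewrite !TE.
set S1 := \sum_(j.+1 <= l < m) _; set S2 := \sum_(j.+1 <= l < m) _.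
set S3 := \sum_(j.+1 <= l < m) _.
(* For [l > j] the factor [Kf j] completes the product from [j.+1] and [exp_fact_step] raises the
   power of [B] by one. *)
have HS : S1 + Kf j * b * S2 <= S3.
  rewrite /S1 /S2 /S3 mulr_sumr -big_split/= big_nat_cond [leRHS]big_nat_cond.
  apply: ler_sum => l; rewrite andbT => /andP[jl lm].
  rewrite (big_ltn jl) -(subnSK jl); set n := (l - j.+1)%N.
  set Pi := \prod_(_ <= k < l) _; have Pi0 : 0 <= Pi by exact/prod_Kf_ge0/ltnW.
  have C0 : 0 <= Kf j * Pi * qf l by rewrite !mulr_ge0 ?Kf0 ?qf0.
  have := exp_fact_step n B0 b0; rewrite [_ + b * _]addrC => h.
  apply: (@le_trans _ _ (Kf j * Pi * qf l *
    (b * (B ^+ n / n`!%:R) + B ^+ n.+1 / n.+1`!%:R) * Rl l)).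
    by rewrite le_eqVlt; apply/orP; left; apply/eqP; ring.
  apply: ler_pM; rewrite ?Rl0 ?lerDr ?rho0//; last first.
    by rewrite [b + B]addrC; apply: (ler_wpM2l C0); exact: h.
  by rewrite mulr_ge0// addr_ge0 ?mulr_ge0 ?divr_ge0 ?exprn_ge0.
rewrite -(subnSK jm) (big_ltn jm); set n := (m - j.+1)%N.
set Pi := \prod_(j.+1 <= k < m) _; have Pi0 : 0 <= Pi by exact: prod_Kf_ge0.
rewrite (big_nat_recr n.+1)//=; set L := \prod_(1 <= k < n.+1) _.
have L0 : 0 <= L.
  by rewrite prodr_ge0// => k _; rewrite invr_ge0 addr_ge0.
set e := e0 + n.+1%:R.
have e_ge1 : 1 <= e by rewrite /e -natr1 addrA lerDr addr_ge0.
(* The same tangent argument at the real exponent [e], whose inverse is the new factor of the last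
   product. *)
have HT : Kf j * Pi * B `^ e * (L * e^-1) + Kf j * b * (Pi * B `^ (e0 + n%:R) * L)
    <= Kf j * Pi * (b + B) `^ e * (L * e^-1).
  have -> : e0 + n%:R = e - 1 by rewrite /e -natr1 addrA addrK.
  have e_gt0 : 0 < e by exact: lt_le_trans e_ge1.
  apply: (@le_trans _ _ ((Kf j * Pi * (L * e^-1)) *
     (B `^ e + e * b * B `^ (e - 1)))).
    rewrite le_eqVlt; apply/orP; left; apply/eqP; field.
    by rewrite gt_eqF.
  rewrite [leRHS]mulrAC [in leRHS](addrC b) ler_wpM2l ?powR_tangent//.
  by rewrite !mulr_ge0 ?Kf0// invr_ge0 ltW.
rewrite mulrDr (mulrDr (qf j)); lra.
Qed.

End iterated_bound.

(** * The Rosenthal-type bound for finite walks *)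

Section rosenthal.
Variables (R : realType) (E : completeNormedModType R) (K : finType) (I : Type).
Variables (v : K -> E) (mu : I -> K -> R).
Hypothesis mu0 : forall i k, 0 <= mu i k.
Hypothesis mu1 : forall i, \sum_k mu i k = 1.
Variables (t : R) (p q : R -> R) (lam : nat -> R) (x y : I -> E).
Hypothesis t2 : 2 < t.
Hypothesis pq : admissible p q.
Hypothesis lam0 : forall j, (j < mt t)%N -> 0 < lam j.
(** Stands for a bound of the sum of the [b_ i]; being positive, it can be divided by even when they
    all vanish. *)
Variable beta : R.
Hypothesis beta0 : 0 < beta.

Let tj (j : nat) := t - (2 * j)%:R.
Let a_ i := \sum_k mu i k * `|v k - x i| `^ t.
Let b_ i := \sum_k mu i k * `|v k - y i| ^+ 2.
(** The weight of [t] when [tj j] is written as a convex combination of [t] and [2]. *)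
Let th j := (tj j - 2) / (t - 2).

Lemma mt_itv : (2 * mt t)%:R <= t < (2 * mt t)%:R + 2.
Proof.
have /truncn_itv : 0 <= t / 2 by rewrite divr_ge0// ltW// (lt_trans _ t2).
by rewrite -/(mt t) natrM -(natr1 (mt t)) => /andP[h1 h2]; apply/andP; split; lra.
Qed.

Lemma mt_gt0 : (0 < mt t)%N.
Proof.
rewrite lt0n; apply/eqP => m0; have /andP[_] := mt_itv.
by rewrite m0 muln0 add0r ltNge ltW.
Qed.

Lemma tj_ge2 j : (j < mt t)%N -> 2 <= tj j.
Proof.
move=> jm; have /andP[h _] := mt_itv; rewrite lerBrDr (le_trans _ h)//.
by rewrite -natrD ler_nat -mulnS leq_mul2l.
Qed.

Lemma admissible_gt0 s : 2 <= s -> 0 < p s /\ 0 < q s.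
Proof.
case: pq => _ p2 q2 h _; rewrite le_eqVlt => /predU1P[<-//|/h[p1 q1]].
by split; exact: lt_le_trans ltr01 _.
Qed.

Lemma cfactor_gt0 j : (j < mt t)%N -> 0 < cfactor p t j.
Proof.
move=> /tj_ge2 h; have [p0 _] := admissible_gt0 h.
rewrite /cfactor -/(tj j) divr_gt0// mulr_gt0// mulr_gt0//; lra.
Qed.

Lemma q_gt0 j : (j < mt t)%N -> 0 < q (tj j).
Proof. by move=> /tj_ge2 /admissible_gt0[]. Qed.

Lemma a_ge0 i : 0 <= a_ i.
Proof. by apply: sumr_ge0 => k _; rewrite mulr_ge0 ?powR_ge0. Qed.

Lemma b_ge0 i : 0 <= b_ i.
Proof. by apply: sumr_ge0 => k _; rewrite mulr_ge0. Qed.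

Lemma th_itv j : (j < mt t)%N -> 0 <= th j <= 1.
Proof.
move=> jm; have h := tj_ge2 jm; have t20 : 0 < t - 2 by rewrite subr_gt0.
apply/andP; split; first by rewrite divr_ge0 ?subr_ge0 ?(ltW t2).
by rewrite ler_pdivrMr// mul1r lerB// lerBlDr lerDl.
Qed.

Lemma th_compl j : 1 - th j = (2 * j)%:R / (t - 2).
Proof. by rewrite /th /tj; field; rewrite gt_eqF// subr_gt0. Qed.

Let coefA j := th j * (lam j ^+ (2 * j))^-1.
Let coefB j := (2 * j)%:R / (t - 2) * (lam j `^ (tj j - 2) * beta `^ (t / 2 - 1)).

Lemma coefA_ge0 j : (j < mt t)%N -> 0 <= coefA j.
Proof.
move=> jm; have /andP[h _] := th_itv jm.
by rewrite mulr_ge0// invr_ge0 exprn_ge0// ltW// lam0.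
Qed.

Lemma coefB_ge0 j : 0 <= coefB j.
Proof.
by rewrite mulr_ge0 ?divr_ge0 ?mulr_ge0 ?powR_ge0// ltW// subr_gt0.
Qed.

(** AM-GM with weight [th j] for [lam^(-2j) X^t] and [lam^(tj - 2) beta^(t/2 - 1) X^2]: the powers
    of [lam] cancel and those of [beta] combine into [beta^j]. *)
Lemma interpolation j (X : R) : (j < mt t)%N -> 0 <= X ->
  X `^ tj j * beta ^+ j <= coefA j * X `^ t + coefB j * X ^+ 2.
Proof.
move=> jm; have cA0 := coefA_ge0 jm; have cB0 := coefB_ge0 j.
have t20 : t - 2 != 0 by rewrite gt_eqF// subr_gt0.
rewrite le_eqVlt => /predU1P[<-|X0].
  rewrite powR0 ?mul0r; first by rewrite addr_ge0// mulr_ge0// powR_ge0.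
  by rewrite gt_eqF// (lt_le_trans _ (tj_ge2 jm)).
have l0 := lam0 jm.
have := @powR_amgm R ((lam j ^+ (2 * j))^-1 * X `^ t)
  (lam j `^ (tj j - 2) * beta `^ (t / 2 - 1) * X ^+ 2) _ _ _ (th_itv jm).
rewrite !mulr_ge0 ?invr_ge0 ?powR_ge0 ?exprn_ge0 ?(ltW l0) ?(ltW X0)//.
move=> /(_ erefl erefl); rewrite th_compl.
have -> : ((lam j ^+ (2 * j))^-1 * X `^ t) `^ th j *
    (lam j `^ (tj j - 2) * beta `^ (t / 2 - 1) * X ^+ 2) `^ ((2 * j)%:R / (t - 2))
    = X `^ tj j * beta ^+ j.
  rewrite -(powR_mulrn (2 * j) (ltW l0)) -(powR_mulrn 2 (ltW X0)).
  rewrite -(powR_mulrn j (ltW beta0)) -powRN.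
  rewrite !powRM ?mulr_ge0 ?powR_ge0// -!powRrM.
  rewrite [LHS](_ : _ =
    (lam j `^ (- (2 * j)%:R * th j) * lam j `^ ((tj j - 2) * ((2 * j)%:R / (t - 2)))) *
    (X `^ (t * th j) * X `^ (2 * ((2 * j)%:R / (t - 2)))) *
    beta `^ ((t / 2 - 1) * ((2 * j)%:R / (t - 2)))); last by ring.
  rewrite -!powRD; [|by rewrite (gt_eqF X0) implybT|by rewrite (gt_eqF l0) implybT].
  have -> : - (2 * j)%:R * th j + (tj j - 2) * ((2 * j)%:R / (t - 2)) = 0.
    by rewrite /th; field.
  have -> : t * th j + 2 * ((2 * j)%:R / (t - 2)) = tj j.
    by rewrite /th /tj; field.
  have -> : (t / 2 - 1) * ((2 * j)%:R / (t - 2)) = j%:R.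
    by rewrite natrM; field.
  by rewrite powRr0 mul1r.
by rewrite /coefA /coefB !mulrA.
Qed.

(** Bound for the conditional moment of order [tj j] of an increment. The division by [beta^j] will
    be offset by the [j]-th power of the sum of the [b_ i]. *)
Let rho i j := (coefA j * (Ct t * a_ i) + coefB j * b_ i) / beta ^+ j.

Lemma rho_ge0 i j : (j < mt t)%N -> 0 <= rho i j.
Proof.
move=> jm; rewrite divr_ge0 ?exprn_ge0 ?(ltW beta0)//.
rewrite addr_ge0// mulr_ge0 ?coefA_ge0 ?coefB_ge0 ?a_ge0 ?b_ge0//.
by rewrite mulr_ge0 ?a_ge0// (le_trans ler01)// Ct_ge1.
Qed.

Lemma sum_incr_tj i F s j : (j < mt t)%N -> nonexpansive F ->
  \sum_k mu i k * `|incr v mu i F s k| `^ tj j <= rho i j.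
Proof.
move=> jm F1; rewrite ler_pdivlMr ?exprn_gt0// mulr_suml.
apply: (@le_trans _ _ (\sum_k (coefA j * (mu i k * `|incr v mu i F s k| `^ t) +
    coefB j * (mu i k * incr v mu i F s k ^+ 2)))).
  apply: ler_sum => k _; rewrite -mulrA.
  apply: (le_trans (ler_wpM2l (mu0 i k) (interpolation jm (normr_ge0 _)))).
  rewrite real_normK ?num_real// le_eqVlt; apply/orP; left; apply/eqP; ring.
rewrite big_split/= -!mulr_sumr lerD// ler_wpM2l ?coefA_ge0 ?coefB_ge0//.
  exact: sum_incr_powR.
exact: sum_incr_sqr.
Qed.

(** The Taylor bound is averaged around the conditional mean: the linear term vanishes, the
    quadratic one is a conditional variance. *)
Lemma step_powR_le i F s j : (j < mt t)%N -> nonexpansive F ->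
  step v mu i (fun s => `|F s| `^ tj j) s <=
  `|step v mu i F s| `^ tj j +
  cfactor p t j * b_ i * `|step v mu i F s| `^ tj j.+1 + q (tj j) * rho i j.
Proof.
move=> jm F1; set A := step v mu i F s.
have s2 := tj_ge2 jm; have q0 := q_gt0 jm; have K0 := cfactor_gt0 jm.
have -> : tj j.+1 = tj j - 2 by rewrite /tj mulnS natrD opprD addrA addrAC.
pose xi := incr v mu i F s.
apply: (@le_trans _ _ (\sum_k (`|A| `^ tj j * mu i k +
    tj j * (A * `|A| `^ (tj j - 2)) * (mu i k * xi k) +
    cfactor p t j * `|A| `^ (tj j - 2) * (mu i k * xi k ^+ 2) +
    q (tj j) * (mu i k * `|xi k| `^ tj j)))).
  apply: ler_sum => k _.
  have := norm_powR_taylor A (xi k) pq s2.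
  rewrite {1}/xi /incr addrCA subrr addr0 => /(ler_wpM2l (mu0 i k)) /le_trans; apply.
  by rewrite /cfactor -/(tj j) le_eqVlt; apply/orP; left; apply/eqP; ring.
rewrite !big_split/= -!mulr_sumr mu1 sum_incr// mulr1 mulr0 addr0.
rewrite lerD//; last first.
  by apply: (ler_wpM2l (ltW q0)); exact: sum_incr_tj.
rewrite lerD2l [leRHS]mulrAC; apply: ler_wpM2l; last exact: sum_incr_sqr.
by rewrite mulr_ge0 ?powR_ge0 ?(ltW K0).
Qed.

(** Orthogonality of martingale differences: the conditional variances add up. *)
Lemma walk_sqr_le r F : nonexpansive F -> walk v mu r F = 0 ->
  walk v mu r (fun s => F s ^+ 2) <= \sum_(i <- r) b_ i.
Proof.
elim: r F => [|i r IH] F F1 /= F0; first by rewrite big_nil F0 expr0n.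
rewrite big_cons addrC; have := IH _ (nonexpansive_step v mu0 mu1 i F1) F0.
rewrite -(lerD2r (b_ i)) => H; apply: (le_trans _ H).
rewrite -[X in _ + X](walk_cst v mu1 r (b_ i)) -walkD; apply: ler_walk => // s.
rewrite /= {1}/step; set A := step v mu i F s.
pose xi := incr v mu i F s.
apply: (@le_trans _ _ (\sum_k (A ^+ 2 * mu i k + 2 * A * (mu i k * xi k) +
   mu i k * xi k ^+ 2))).
  by apply: ler_sum => k _; rewrite /xi /incr -/A le_eqVlt; apply/orP; left;
    apply/eqP; ring.
rewrite !big_split/= -!mulr_sumr mu1 sum_incr// mulr1 mulr0 addr0.
by rewrite lerD2l sum_incr_sqr.
Qed.

(** Induction on the steps for all [j] at once, since the bound for order [tj j] calls for orders
    [tj j] and [tj j.+1] one step earlier; [step i F] is again 1-Lipschitz with mean zero. *)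
Lemma walk_powR_iterated r F j : (j <= mt t)%N -> nonexpansive F ->
  walk v mu r F = 0 ->
  walk v mu r (fun s => `|F s| `^ tj j) <=
  iterated_bound (mt t) (t / 2 - (mt t)%:R) (cfactor p t) (fun j => q (tj j))
    (fun l => \sum_(i <- r) rho i l) (\sum_(i <- r) b_ i) j.
Proof.
have /andP[tm1 tm2] := mt_itv.
have e00 : 0 <= t / 2 - (mt t)%:R by move: tm1; rewrite natrM; lra.
have e01 : t / 2 - (mt t)%:R <= 1 by move: tm2; rewrite natrM; lra.
have Kf0 l : (l < mt t)%N -> 0 <= cfactor p t l by move=> /cfactor_gt0/ltW.
have qf0 l : (l < mt t)%N -> 0 <= q (tj l) by move=> /q_gt0/ltW.
have sb0 r' : 0 <= \sum_(i <- r') b_ i by apply: sumr_ge0 => i _; exact: b_ge0.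
have sr0 r' l : (l < mt t)%N -> 0 <= \sum_(i <- r') rho i l.
  by move=> lm; apply: sumr_ge0 => i _; exact: rho_ge0.
(* After [mt t] reductions the order lies in [[0, 2)], so Jensen's inequality reduces it to the
   second moment. *)
have last_step r' F' : nonexpansive F' -> walk v mu r' F' = 0 ->
    walk v mu r' (fun s => `|F' s| `^ tj (mt t)) <=
    (\sum_(i <- r') b_ i) `^ (t / 2 - (mt t)%:R).
  move=> F1 F0.
  have -> : (fun s => `|F' s| `^ tj (mt t)) =
      (fun s => (F' s ^+ 2) `^ (t / 2 - (mt t)%:R)).
    apply/funext => s; rewrite -real_normK ?num_real// -(powR_mulrn 2)//.
    by rewrite -powRrM; congr (_ `^ _); rewrite /tj natrM; field.
  apply: walk_powR_le => //; first by move=> s; exact: sqr_ge0.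
    exact: walk_sqr_le.
  by rewrite e00.
elim: r F j => [|i r IH] F j; rewrite leq_eqVlt => /predU1P[->|jm] F1 F0.
- by rewrite iterated_bound_m; exact: last_step.
- rewrite /= in F0 *; rewrite F0 normr0 powR0; last first.
    by rewrite gt_eqF// (lt_le_trans _ (tj_ge2 jm)).
  exact: (iterated_bound_ge0 e00 Kf0 qf0 _ (sb0 [::]) (sr0 [::])).
- by rewrite iterated_bound_m; exact: last_step.
have F1' := nonexpansive_step v mu0 mu1 i F1.
have H := fun s => step_powR_le i s jm F1.
apply: (le_trans (ler_walk v mu0 r H)).
rewrite !walkD walkZ walk_cst//.
have {}IH := fun j jm => IH _ j jm F1' F0.
set U := iterated_bound _ _ _ _ in IH *.
under [X in U X]eq_fun do rewrite big_cons.
rewrite big_cons.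
apply: le_trans (iterated_bound_step e00 Kf0 qf0 jm (sb0 r) (b_ge0 i) (sr0 r)
  (fun l => @rho_ge0 i l)).
rewrite lerD2r lerD ?IH// ?(ltnW jm)// ler_wpM2l ?IH//.
by rewrite mulr_ge0 ?b_ge0// Kf0.
Qed.

(** The iterated bound at [j = 0] for [F] minus its mean, compared with the constants term by
    term. *)
Theorem walk_rosenthal r F : nonexpansive F -> \sum_(i <- r) b_ i <= beta ->
  walk v mu r (fun s => `|F s - walk v mu r F| `^ t) <=
  Ct t * CA p q lam t * (\sum_(i <- r) a_ i) + CB p q lam t * beta `^ (t / 2).
Proof.
move=> F1 Bbeta; set c := walk v mu r F; set B := \sum_(i <- r) b_ i in Bbeta.
set SA := \sum_(i <- r) a_ i.
have B0 : 0 <= B by apply: sumr_ge0 => i _; exact: b_ge0.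
have SA0 : 0 <= SA by apply: sumr_ge0 => i _; exact: a_ge0.
have C1 := Ct_ge1 t2; have C0 := le_trans ler01 C1.
pose G s := F s + (-1) * c.
have G1 : nonexpansive G.
  by move=> s s'; rewrite /G opprD addrACA subrr addr0.
have G0 : walk v mu r G = 0.
  by rewrite /G walkD walk_cst// -/c mulN1r subrr.
have := walk_powR_iterated (leq0n _) G1 G0.
rewrite /tj muln0 subr0 /G -/tj.
under [X in walk v mu r X]eq_fun do rewrite mulN1r.
move=> /le_trans; apply; rewrite /iterated_bound -/B !subn0 subrK.
have -> : Ct t * CA p q lam t * SA + CB p q lam t * beta `^ (t / 2) =
  \sum_(0 <= l < mt t) (Ct t * (cj p q t l * ((t - (2 * l)%:R - 2) / (t - 2)) *
    (lam l ^+ (2 * l) * l`!%:R)^-1) * SA +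
    cj p q t l * ((2 * l)%:R / (t - 2)) *
    (lam l `^ (t - (2 * l)%:R - 2) / l`!%:R) * beta `^ (t / 2)) +
  ctilde p t * \prod_(1 <= j < (mt t).+1) (t / 2 - (mt t)%:R + j%:R)^-1 *
   beta `^ (t / 2).
  rewrite big_split/= -!mulr_suml -mulr_sumr -/(CA p q lam t).
  by rewrite /CB; ring.
rewrite lerD//; last first.
  rewrite mulrAC ler_wpM2l//.
    rewrite mulr_ge0//.
      rewrite big_nat_cond prodr_ge0// => k; rewrite andbT => /andP[_ km].
      by rewrite ltW// cfactor_gt0.
    have /andP[tm1 _] := mt_itv; rewrite natrM in tm1.
    rewrite prodr_ge0// => k _; rewrite invr_ge0 addr_ge0//; lra.
  by rewrite ge0_ler_powR ?nnegrE ?(ltW beta0)// divr_ge0// ltW// (lt_trans _ t2).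
rewrite big_nat_cond [leRHS]big_nat_cond; apply: ler_sum => l.
rewrite andbT => /andP[_ lm]; rewrite subn0.
have cA0 := coefA_ge0 lm; have cB0 := coefB_ge0 l.
have f0 : 0 < l`!%:R :> R by rewrite ltr0n fact_gt0.
have bl0 : 0 < beta ^+ l by rewrite exprn_gt0.
have cj0 : 0 <= cj p q t l / l`!%:R.
  rewrite divr_ge0 ?(ltW f0)// mulr_ge0 ?(ltW (q_gt0 lm))//.
  rewrite big_nat_cond prodr_ge0// => k; rewrite andbT => /andP[_ kl].
  by rewrite ltW// cfactor_gt0// (ltn_trans kl).
(* [B <= beta] cancels the denominator [beta^l] of [rho] and bounds the remaining [B]; the leftover
   [coefB l * beta] supplies [beta^(t/2)]. *)
have key : B ^+ l * \sum_(i <- r) rho i l <=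
    coefA l * (Ct t * SA) + coefB l * beta.
  have -> : \sum_(i <- r) rho i l =
      (coefA l * (Ct t * SA) + coefB l * B) / beta ^+ l.
    by rewrite -mulr_suml big_split/= -!mulr_sumr.
  rewrite mulrA ler_pdivrMr// mulrC.
  apply: ler_pM; rewrite ?exprn_ge0//.
  - by rewrite addr_ge0// mulr_ge0// mulr_ge0.
  - by rewrite lerD2l ler_wpM2l.
  - by rewrite lerXn2r// nnegrE ltW.
have := ler_wpM2l cj0 key.
have bE : beta `^ (t / 2) = beta `^ (t / 2 - 1) * beta.
  rewrite [RHS]mulrC mulr_powRB1 ?(ltW beta0)//.
  by rewrite divr_gt0// (lt_trans _ t2).
have l0 : lam l ^+ (2 * l) != 0 by rewrite expf_neq0// gt_eqF// lam0.
have t20 : t - 2 != 0 by rewrite gt_eqF// subr_gt0.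
rewrite bE /coefA /coefB /th /tj /cj; move: (Ct t) {C0 C1} => C.
move: (\sum_(i <- r) rho i l) => S.
have fn0 := lt0r_neq0 f0.
move=> h; apply: le_trans (le_trans _ h) _; rewrite le_eqVlt; apply/orP; left;
  apply/eqP; field; rewrite ?l0 ?t20 ?fn0//.
Qed.

End rosenthal.

(** * Independent variables with finitely many values *)

Section discrete_independence.
Variables (R : realType) (d : measure_display) (T : measurableType d).
Variables (P : probability T R) (E : completeNormedModType R) (n : nat).
Variables (K : finType) (J : 'I_n -> T -> K) (v : K -> E).
Hypothesis mJ : forall i (B : set K), measurable (J i @^-1` B).
Hypothesis indepJ : forall (A : {set 'I_n}) (B : 'I_n -> set K),
  P (\bigcap_(i in [set` A]) (J i @^-1` B i)) =
  (\prod_(i in A) P (J i @^-1` B i))%E.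

Definition law (i : 'I_n) (k : K) : R := fine (P (J i @^-1` [set k])).

Lemma law_ge0 i k : 0 <= law i k.
Proof. by rewrite fine_ge0. Qed.

Lemma walk_sum (I : Type) (mu : I -> K -> R) (r : seq I) (c : K -> R)
    (F : K -> E -> R) :
  walk v mu r (fun s => \sum_k c k * F k s) = \sum_k c k * walk v mu r (F k).
Proof.
elim: r F => [//|i r IH] F /=; rewrite -IH; congr walk; apply/funext => s.
rewrite /step (eq_bigr _ (fun k _ => mulr_sumr _ _ _ _)) exchange_big/=.
apply: eq_bigr => l _; rewrite mulr_sumr; apply: eq_bigr => k _.
by rewrite mulrCA.
Qed.

Let rest (r : seq 'I_n) : {set 'I_n} := ~: [set i in r].

(** A condition on the variables outside [r]; carrying it through the induction takes the place of
    conditioning. *)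
Definition rest_event (r : seq 'I_n) (B : 'I_n -> set K) : set T :=
  \bigcap_(i in [set` rest r]) (J i @^-1` B i).

Lemma measurable_rest_event r B : measurable (rest_event r B).
Proof.
apply: fin_bigcap_measurable => //; exact: finite_finset.
Qed.

Lemma rest_event_cons i r B k : i \notin r ->
  P (rest_event r (fun l => if l == i then [set k] else B l)) =
  ((law i k)%:E * P (rest_event (i :: r) B))%E.
Proof.
move=> ir; rewrite /rest_event !indepJ (bigD1 i)/=; last by rewrite !inE.
rewrite eqxx /law fineK ?fin_num_measure//; congr (_ * _)%E.
apply: eq_big => [l|l]; first by rewrite !inE negb_or andbC.
by move=> /andP[_ /negPf ->].
Qed.

(** Splitting over the value [k] of [J i] moves the index [i] from the sum to the event; the
    induction hypothesis applies to [G] shifted by [v k], and independence extracts [law i k]. *)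
Lemma integral_walk (r : seq 'I_n) (G : E -> R) (B : 'I_n -> set K) : uniq r ->
  P.-integrable setT
    (fun w => (G (\sum_(i <- r) v (J i w)) * \1_(rest_event r B) w)%:E) /\
  (\int[P]_w (G (\sum_(i <- r) v (J i w)) * \1_(rest_event r B) w)%:E =
   (walk v law r G)%:E * P (rest_event r B))%E.
Proof.
elim: r G B => [|i r IH] G B.
  move=> _; have mB := measurable_rest_event [::] B.
  have i1 := integrable_indic P mB.
  have E0 w : (G (\sum_(i <- [::]) v (J i w)) * \1_(rest_event [::] B) w)%:E =
      ((G 0)%:E * (\1_(rest_event [::] B) w)%:E)%E by rewrite big_nil EFinM.
  split; first by under eq_fun do rewrite E0; exact: integrableZl.
  under eq_integral do rewrite E0.
  by rewrite integralZl// integral_indic// setIT.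
move=> /= /andP[ir ur].
pose Bk k l := if l == i then [set k] else B l.
(* Only the term [k = J i w] is nonzero. *)
have E1 w : (G (\sum_(i <- i :: r) v (J i w)) * \1_(rest_event (i :: r) B) w)%:E =
    (\sum_k (G (\sum_(i <- r) v (J i w) + v k) * \1_(rest_event r (Bk k)) w)%:E)%E.
  rewrite [RHS](bigD1 (J i w))//= [X in (_ + X)%E]big1 ?adde0; last first.
    move=> k kJ; rewrite indicE memNset ?mulr0// => /(_ i).
    rewrite /= !inE ir => /(_ isT).
    by rewrite /Bk eqxx /= => kE; rewrite kE eqxx in kJ.
  rewrite big_cons [v _ + _]addrC; congr (_ * _)%:E.
  rewrite !indicE; congr ((nat_of_bool _)%:R).
  apply/idP/idP => /set_mem H; apply/mem_set => l /= lr.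
    rewrite /Bk; case: eqVneq => [->//|li]; apply: H => /=.
    by move: lr; rewrite !inE (negPf li).
  have : J l w \in Bk (J i w) l.
    by apply/mem_set/H; move: lr; rewrite /= !inE negb_or => /andP[].
  rewrite /Bk; case: eqVneq => [li|_ /set_mem//].
  by move: lr; rewrite /= !inE li eqxx.
have IHk k := IH (fun s => G (s + v k)) (Bk k) ur.
split.
  rewrite (_ : (fun w => _) = (fun w => \sum_k
    (G (\sum_(i <- r) v (J i w) + v k) * \1_(rest_event r (Bk k)) w)%:E)%E); last first.
    by apply/funext => w; exact: E1.
  by apply: integrable_sum => // k _; case: (IHk k).
under eq_integral do rewrite E1.
rewrite integral_sum//; last by move=> k; case: (IHk k).
have Pfin : (fine (P (rest_event (i :: r) B)))%:E = P (rest_event (i :: r) B).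
  by rewrite fineK// fin_num_measure//; exact: measurable_rest_event.
rewrite (eq_bigr (fun k => (law i k * walk v law r (fun s => G (s + v k)) *
    fine (P (rest_event (i :: r) B)))%:E)); last first.
  move=> k _; case: (IHk k) => _ ->; rewrite rest_event_cons//.
  by rewrite -Pfin -!EFinM mulrA [law i k * _]mulrC.
by rewrite sumEFin -mulr_suml -walk_sum EFinM Pfin.
Qed.

Lemma rest_event_setT r : rest_event r (fun=> setT) = setT.
Proof. by apply/seteqP; split. Qed.

Lemma expectation_walk (r : seq 'I_n) (G : E -> R) : uniq r ->
  P.-integrable setT (fun w => (G (\sum_(i <- r) v (J i w)))%:E) /\
  ('E_P[(fun w => G (\sum_(i <- r) v (J i w)))%R] = (walk v law r G)%:E)%E.
Proof.
move=> ur; have [] := integral_walk G (fun=> setT) ur.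
rewrite rest_event_setT probability_setT mule1.
have E1 w : G (\sum_(i <- r) v (J i w)) * \1_setT w = G (\sum_(i <- r) v (J i w)).
  by rewrite indicT mulr1.
under eq_fun do rewrite E1.
move=> H1 <-; split=> //; rewrite unlock.
by apply: eq_integral => w _; congr EFin; rewrite -[LHS]E1.
Qed.

Lemma expectation_law i (g : E -> R) :
  ('E_P[(fun w => g (v (J i w)))%R] = (\sum_k law i k * g (v k))%R%:E)%E.
Proof.
have [_ H] := @expectation_walk [:: i] g isT.
rewrite (_ : (fun w => g (v (J i w))) =
    fun w => g (\sum_(j <- [:: i]) v (J j w))); last first.
  by apply/funext => w; rewrite big_seq1.
by rewrite H; congr EFin; apply: eq_bigr => k _; rewrite add0r.
Qed.

Lemma law_sum1 i : \sum_k law i k = 1.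
Proof.
have := expectation_law i (fun=> 1); rewrite expectation_cst => -[->].
by apply: eq_bigr => k _; rewrite mulr1.
Qed.

End discrete_independence.

(** * Approximation by finitely many values *)

Section nearest.
Variables (R : realType) (E : completeNormedModType R) (e : nat -> E).

(** Ties keep the earlier index. The recursion involves only comparisons of distances, which makes
    measurability an easy induction. *)
Fixpoint nearest (k : nat) (x : E) : nat :=
  if k is k'.+1 then
    if `|x - e k| < `|x - e (nearest k' x)| then k else nearest k' x
  else 0.

Lemma nearest_le k x : (nearest k x <= k)%N.
Proof. by elim: k => [//|k IH] /=; case: ifP => // _; exact: leqW. Qed.

Lemma nearest_min k x j : (j <= k)%N -> `|x - e (nearest k x)| <= `|x - e j|.
Proof.
elim: k j => [|k IH] j; first by rewrite leqn0 => /eqP ->.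
rewrite leq_eqVlt => /predU1P[->|jk] /=; case: ltP => //.
by move=> /ltW/le_trans; apply; exact: IH.
by move=> _; exact: IH.
Qed.

Lemma cvg_nearest x : (forall eps : R, 0 < eps -> exists j, `|x - e j| < eps) ->
  e (nearest k x) @[k --> \oo] --> x.
Proof.
move=> dense_e; apply/cvgrPdist_lt => eps /dense_e[j xj].
by exists j => // k /= jk; apply: le_lt_trans xj; exact: nearest_min.
Qed.

Lemma measurable_norm_sub (c : E) :
  measurable_fun setT ((fun x => `|x - c|) : borel E -> R).
Proof.
apply: (measurability _ (RGenOInfty.measurableE R)).
move=> _ [_ [a ->] <-]; rewrite setTI; apply: sub_sigma_algebra.
apply: open_comp; last exact: rray_open.
move=> z _; apply: (@continuous_comp _ _ _ (fun x : E => x - c) Num.norm).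
  by apply: cvgB; [exact: cvg_id|exact: cvg_cst].
exact: norm_continuous.
Qed.

(** The two claims are proved together because each choice compares with the distance reached so
    far. *)
Lemma measurable_nearest k :
  measurable_fun setT (nearest k : borel E -> nat) /\
  measurable_fun setT ((fun x => `|x - e (nearest k x)|) : borel E -> R).
Proof.
elim: k => [|k [IHn IHd]]; first by split => //=; exact: measurable_norm_sub.
have mlt : measurable_fun setT
    ((fun x => `|x - e k.+1| < `|x - e (nearest k x)|) : borel E -> bool).
  by apply: measurable_fun_ltr => //; exact: measurable_norm_sub.
split; first exact: measurable_fun_ifT.
rewrite (_ : (fun x => _) = (fun x => if `|x - e k.+1| < `|x - e (nearest k x)|
  then `|x - e k.+1| else `|x - e (nearest k x)|)).
  by apply: measurable_fun_ifT => //; exact: measurable_norm_sub.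
by apply/funext => x /=; case: ifP.
Qed.

End nearest.

Lemma separable_dense_seq (R : realType) (E : completeNormedModType R) :
  separable E -> exists e : nat -> E,
    forall x (eps : R), 0 < eps -> exists j, `|x - e j| < eps.
Proof.
move=> [D [cD dD]].
have D0 : D !=set0.
  by have [||x [_ Dx]] := dD setT; [exists 0|exact: openT|exists x].
have [e De] : exists e : nat -> E, D `<=` range e.
  have /pcard_surjP[e De] := cD.
  by exists e => x /De[j _ <-]; exists j.
exists e => x eps eps0.
have [||z [/= xz Dz]] := dD (ball x eps).
- by exists x; exact: ballxx.
- exact: ball_open.
by have [j _ jz] := De _ Dz; exists j; rewrite jz -ball_normE in xz *.
Qed.

(** * Passage to the limit *)

Lemma lee_limn_einf (R : realType) (u v : (\bar R)^nat) :
  (forall k, (u k <= v k)%E) -> (limn_einf u <= limn_einf v)%E.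
Proof.
move=> uv; rewrite !limn_einf_lim; apply: lee_lim; try exact: is_cvg_einfs.
apply: nearW => k; apply: le_ereal_inf_tmp => _ [l /= kl <-].
by apply: le_trans (uv l); apply: ereal_inf_lbound; exists l.
Qed.

Section expectation_limits.
Variables (R : realType) (d : measure_display) (T : measurableType d).
Variables (P : probability T R) (f_ : nat -> T -> R) (f : T -> R).
Hypothesis mf_ : forall k, measurable_fun setT (f_ k).
Hypothesis f_f : forall w, f_ k w @[k --> \oo] --> f w.

(** Serves the left-hand side, where an upper bound in the limit is enough and no dominating
    function has to be found. *)
Lemma expectation_fatou (r_ : nat -> R) (r : R) : (forall k w, 0 <= f_ k w) ->
  (forall k, ('E_P[f_ k] <= (r_ k)%:E)%E) -> r_ k @[k --> \oo] --> r ->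
  ('E_P[f] <= r%:E)%E.
Proof.
move=> f0 fr rr; rewrite unlock.
have mE k : measurable_fun setT (EFin \o f_ k) by exact/measurable_EFinP.
have E0 k w : setT w -> (0 <= (EFin \o f_ k) w)%E by rewrite /= lee_fin.
have := fatou P measurableT mE E0.
rewrite (eq_integral (fun w => (f w)%:E)); last first.
  move=> w _; have c : (f_ k w)%:E @[k --> \oo] --> (f w)%:E.
    by apply: cvg_EFin; [exact: nearW|exact: f_f].
  by have [-> _] := cvg_limn_einf_sup c.
move=> /le_trans; apply.
have rrE : (r_ k)%:E @[k --> \oo] --> r%:E.
  by apply: cvg_EFin; [exact: nearW|exact: rr].
have [<- _] := cvg_limn_einf_sup rrE.
by apply: lee_limn_einf => k; have := fr k; rewrite unlock.
Qed.

(** Serves the mean and the moments on the right, where true convergence is required. *)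
Lemma expectation_cvg (g : T -> R) : P.-integrable setT (EFin \o g) ->
  (forall k w, `|f_ k w| <= g w) ->
  P.-integrable setT (EFin \o f) /\
  fine 'E_P[f_ k] @[k --> \oo] --> fine 'E_P[f].
Proof.
move=> ig fg.
have mE k : measurable_fun setT (EFin \o f_ k) by exact/measurable_EFinP.
have cE w : setT w -> (EFin \o f_ k) w @[k --> \oo] --> (EFin \o f) w.
  by move=> _; apply: cvg_EFin; [exact: nearW|exact: f_f].
have gE k w : setT w -> (`|(EFin \o f_ k) w| <= (EFin \o g) w)%E.
  by move=> _; rewrite /= lee_fin.
have mf : measurable_fun setT (EFin \o f).
  exact: (emeasurable_fun_cvg _ _ mE cE).
have [iF _ cF] := @dominated_convergence _ _ _ P setT measurableT _ _ _ mE mf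
  (aeW _ cE) ig (aeW _ (fun w k => gE k w)).
split=> //; rewrite unlock; apply: fine_cvg; rewrite fineK ?integrable_fin_num//.
Qed.

End expectation_limits.

(** The sum [2 u + c] is at most [4 u] or at most [2 c], and [u^s <= 1 + u^t]. *)
Lemma powR_dominated (R : realType) (u c s t : R) : 0 <= u -> 0 <= c ->
  0 < s <= t ->
  (2 * u + c) `^ s <= 4 `^ s * (1 + u `^ t) + (2 * c) `^ s.
Proof.
move=> u0 c0 /andP[s0 st].
have us : u `^ s <= 1 + u `^ t.
  have [u1|/ltW u1] := leP u 1.
    rewrite (@le_trans _ _ (1 `^ s)) ?ge0_ler_powR ?nnegrE ?(ltW s0)//.
    by rewrite powR1 lerDl powR_ge0.
  by rewrite (le_trans (ler_powR u1 st))// lerDr.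
have us4 : (4 * u) `^ s <= 4 `^ s * (1 + u `^ t).
  by rewrite powRM// ler_wpM2l ?powR_ge0.
have [cu|/ltW uc] := leP c (2 * u).
  apply: (@le_trans _ _ ((4 * u) `^ s)).
    by rewrite ge0_ler_powR ?nnegrE ?(ltW s0)//; lra.
  by rewrite (le_trans us4)// lerDl powR_ge0.
apply: (@le_trans _ _ ((2 * c) `^ s)).
  by rewrite ge0_ler_powR ?nnegrE ?(ltW s0)//; lra.
by rewrite lerDr mulr_ge0 ?powR_ge0// addr_ge0 ?powR_ge0.
Qed.

(** * Rounding the random vectors to finitely many values *)

Section discretization.
Variables (R : realType) (d : measure_display) (T : measurableType d).
Variables (P : probability T R) (E : completeNormedModType R) (n : nat).
Variable X : 'I_n -> T -> E.
Hypothesis hX : forall i, random_vector (X i).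
Hypothesis hindep : independent P X.
Variable e : nat -> E.

Definition rounded k (i : 'I_n) (w : T) : E := e (nearest e k (X i w)).

Lemma measurable_nearest_preimage k i (B : set nat) :
  measurable ((fun w => nearest e k (X i w)) @^-1` B).
Proof.
have := measurableT_comp (measurable_nearest e k).1 (hX i).
by move=> /(_ measurableT B I); rewrite setTI.
Qed.

(** The index as an element of a finite type, as the results on finite walks require; [inord] loses
    nothing since the index is at most [k]. *)
Definition cell k (i : 'I_n) (w : T) : 'I_k.+1 := inord (nearest e k (X i w)).

Lemma rounded_cell k i w : rounded k i w = e (cell k i w).
Proof. by rewrite /rounded /cell inordK// ltnS nearest_le. Qed.

Lemma measurable_cell k i (B : set 'I_k.+1) : measurable (cell k i @^-1` B).
Proof. exact: (measurable_nearest_preimage k i [set j | B (inord j)]). Qed.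

Lemma independent_cell k (A : {set 'I_n}) (B : 'I_n -> set 'I_k.+1) :
  P (\bigcap_(i in [set` A]) (cell k i @^-1` B i)) =
  (\prod_(i in A) P (cell k i @^-1` B i))%E.
Proof.
apply: (hindep (B := fun i => nearest e k @^-1` [set j | B i (inord j)])).
move=> i _; have := (measurable_nearest e k).1 measurableT.
by move=> /(_ [set j | B i (inord j)] I); rewrite setTI.
Qed.

Lemma expectation_rounded k (G : E -> R) :
  P.-integrable setT (fun w => (G (\sum_(i < n) rounded k i w))%:E) /\
  ('E_P[(fun w => G (\sum_(i < n) rounded k i w))%R] =
   (walk (fun j : 'I_k.+1 => e j) (law P (@cell k)) (index_enum 'I_n) G)%:E)%E.
Proof.
have := expectation_walk (fun j : 'I_k.+1 => e j) (@measurable_cell k)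
  (@independent_cell k) G (index_enum_uniq 'I_n).
rewrite (_ : (fun w => G (\sum_(i < n) e (cell k i w))) =
  (fun w => G (\sum_(i < n) rounded k i w)))//.
  rewrite (_ : (fun w => (G (\sum_(i < n) e (cell k i w)))%:E) =
    (fun w => (G (\sum_(i < n) rounded k i w))%:E))//.
  by apply/funext => w; under [in RHS]eq_bigr do rewrite rounded_cell.
by apply/funext => w; under [in RHS]eq_bigr do rewrite rounded_cell.
Qed.

(** The bound for walks with [beta] the sum of the second moments plus [delta], which keeps it
    positive. *)
Lemma rounded_bound (t : R) (p q : R -> R) (lam : nat -> R) (x y : 'I_n -> E)
    (k : nat) (delta : R) :
  2 < t -> admissible p q -> (forall j, (j < mt t)%N -> 0 < lam j) ->
  0 < delta ->
  ('E_P[(fun w => `| `|\sum_(i < n) rounded k i w|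
      - fine 'E_P[fun w => `|\sum_(i < n) rounded k i w| ]%R| `^ t)%R] <=
   (Ct t * CA p q lam t *
      (\sum_(i < n) fine 'E_P[fun w => `|rounded k i w - x i| `^ t]%R) +
    CB p q lam t *
      (\sum_(i < n) fine 'E_P[fun w => `|rounded k i w - y i| ^+ 2]%R + delta)
      `^ (t / 2))%:E)%E.
Proof.
move=> t2 pq lam0 delta0.
pose J := @cell k; pose v (j : 'I_k.+1) := e j.
have mJ := @measurable_cell k; have indepJ := @independent_cell k.
have walkE (G : E -> R) :
    ('E_P[(fun w => G (\sum_(i < n) rounded k i w))%R] =
     (walk v (law P J) (index_enum 'I_n) G)%:E)%E.
  by case: (expectation_rounded k G).
have lawE i (g : E -> R) : fine ('E_P[(fun w => g (rounded k i w))%R])%E =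
    \sum_j law P J i j * g (v j).
  have := expectation_law v mJ indepJ i g => /(congr1 fine) /= <-.
  by congr (fine (expectation _ _)); apply/funext => w; rewrite rounded_cell.
have mu0 := law_ge0 P J.
have mu1 := law_sum1 v mJ indepJ.
rewrite (walkE (fun s => `|s|)) [fine _]/=.
rewrite (walkE (fun s => `| `|s| - _ | `^ t)) lee_fin.
under eq_bigr do rewrite (lawE _ (fun s => `|s - x _| `^ t)).
under [X in (X + delta) `^ _]eq_bigr do rewrite (lawE _ (fun s => `|s - y _| ^+ 2)).
set b := \sum_(i < n) \sum_j _ * _ ^+ 2.
have b0 : 0 <= b.
  by apply: sumr_ge0 => i _; apply: sumr_ge0 => j _; rewrite mulr_ge0.
have beta0 : 0 < b + delta by rewrite ltr_wpDl.
apply: (@walk_rosenthal R E _ _ v _ mu0 mu1 t p q lam x y t2 pq lam0 _ beta0).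
  by move=> s s'; exact: ler_dist_dist.
by rewrite lerDl ltW.
Qed.

End discretization.

Lemma cvg_norm_powR (R : realType) (s : R) (f : nat -> R) (a : R) : 0 < s ->
  f k @[k --> \oo] --> a -> `|f k| `^ s @[k --> \oo] --> `|a| `^ s.
Proof.
by move=> s0 fa; exact: (cvg_comp _ _ fa (continuous_norm_powR s0 (x := a))).
Qed.

Lemma cvg_sum (R : numFieldType) (V : normedModType R) (n : nat)
    (f : 'I_n -> nat -> V) (a : 'I_n -> V) :
  (forall i, f i k @[k --> \oo] --> a i) ->
  \sum_(i < n) f i k @[k --> \oo] --> \sum_(i < n) a i.
Proof. by move=> fa; apply: cvg_big => //; exact: add_continuous. Qed.

(** * The limit when the moments of order [t] are finite *)

Section finite_moments.
Variables (R : realType) (d : measure_display) (T : measurableType d).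
Variables (P : probability T R) (E : completeNormedModType R) (n : nat).
Variable X : 'I_n -> T -> E.
Hypothesis hX : forall i, random_vector (X i).
Hypothesis hindep : independent P X.
Variable e : nat -> E.
Hypothesis dense_e : forall x (eps : R), 0 < eps -> exists j, `|x - e j| < eps.
Variables (t : R) (x : 'I_n -> E).
Hypothesis t2 : 2 < t.
Hypothesis finX : forall i, ('E_P[(fun w => `|X i w - x i| `^ t)%R] < +oo)%E.

Let Z := rounded X e.

Lemma measurable_norm_randomB i c : measurable_fun setT (fun w => `|X i w - c|).
Proof. exact: (measurableT_comp (measurable_norm_sub c) (hX i)). Qed.

Lemma measurable_norm_roundedB k i c :
  measurable_fun setT (fun w => `|Z k i w - c|).
Proof.
move=> _ B mB; rewrite setTI.
exact: (measurable_nearest_preimage hX e k i [set j | B `|e j - c|]).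
Qed.

Lemma cvg_rounded i w : Z k i w @[k --> \oo] --> X i w.
Proof. exact: (cvg_nearest (dense_e (X i w))). Qed.

Lemma integrable_moment i : P.-integrable setT (fun w => (`|X i w - x i| `^ t)%:E).
Proof.
apply/integrableP; split.
  apply/measurable_EFinP.
  exact: (measurableT_comp (measurable_powR t) (measurable_norm_randomB i (x i))).
have := finX i; rewrite unlock; congr (_ < _)%E; apply: eq_integral => w _.
by rewrite /= ger0_norm ?powR_ge0.
Qed.

(** Since [e 0] is always a candidate, the rounding error is at most [|X i w - e 0|], which gives a
    bound uniform in [k]. *)
Lemma norm_rounded_le k i w z :
  `|Z k i w - z| <= 2 * `|X i w - x i| + (`|x i - e 0| + `|x i - z|).
Proof.
have h1 : `|X i w - Z k i w| <= `|X i w - e 0| by exact: nearest_min.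
have h2 := ler_distD (x i) (X i w) (e 0).
have h3 := ler_distD (X i w) (Z k i w) z.
have h4 := ler_distD (x i) (X i w) z.
rewrite (distrC (Z k i w) (X i w)) in h3; lra.
Qed.

Let dominator s (c : R) i w := 4 `^ s * (1 + `|X i w - x i| `^ t) + (2 * c) `^ s.

Lemma integrable_dominator s c i : P.-integrable setT (EFin \o dominator s c i).
Proof.
rewrite (_ : EFin \o _ = ((fun w => (4 `^ s)%:E * ((cst 1%:E \+
   (fun w => (`|X i w - x i| `^ t)%:E)) w)) \+ cst ((2 * c) `^ s)%:E)%E).
  apply: integrableD => //; last exact: finite_measure_integrable_cst.
  apply: integrableZl => //; apply: integrableD => //.
    exact: (finite_measure_integrable_cst _ 1).
  exact: integrable_moment.
by apply/funext => w /=.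
Qed.

(** A finite moment of order [t] about [x i] dominates those of every order [s <= t] about any point
    [z], in particular the second moments about [y i]. *)
Lemma cvg_moment s i z : 0 < s <= t ->
  P.-integrable setT (fun w => (`|X i w - z| `^ s)%:E) /\
  fine ('E_P[(fun w => `|Z k i w - z| `^ s)%R])%E @[k --> \oo] -->
  fine ('E_P[(fun w => `|X i w - z| `^ s)%R])%E.
Proof.
move=> st; have /andP[s0 _] := st.
apply: (expectation_cvg _ _ (integrable_dominator s (`|x i - e 0| + `|x i - z|) i)).
- move=> k.
  exact: (measurableT_comp (measurable_powR s) (measurable_norm_roundedB k i z)).
- move=> w; have cn : `|Z k i w - z| @[k --> \oo] --> `|X i w - z|.
    by apply: cvg_norm; apply: cvgB; [exact: cvg_rounded|exact: cvg_cst].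
  have := cvg_norm_powR s0 cn; rewrite normr_id.
  by under eq_fun do rewrite normr_id.
- move=> k w; rewrite ger0_norm ?powR_ge0//.
  apply: le_trans (powR_dominated _ _ st) => //.
  by rewrite ge0_ler_powR ?nnegrE ?(ltW s0) ?addr_ge0 ?mulr_ge0 ?norm_rounded_le.
Qed.

Lemma cvg_norm_sum_rounded w :
  `|\sum_(i < n) Z k i w| @[k --> \oo] --> `|\sum_(i < n) X i w|.
Proof.
by apply: cvg_norm; apply: cvg_sum => i; exact: cvg_rounded.
Qed.

Lemma measurable_norm_sum_rounded k :
  measurable_fun setT (fun w => `|\sum_(i < n) Z k i w|).
Proof.
have [/integrableP[/measurable_EFinP h _] _] :=
  expectation_rounded hX hindep e k (fun s => `|s|).
exact: h.
Qed.

Lemma cvg_mean_rounded :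
  fine ('E_P[(fun w => `|\sum_(i < n) Z k i w|)%R])%E @[k --> \oo] -->
  fine ('E_P[(fun w => `|\sum_(i < n) X i w|)%R])%E.
Proof.
pose c i := `|x i - e 0| + `|x i - 0|.
pose g w := \sum_(i < n) dominator 1 (c i) i w.
have ig : P.-integrable setT (EFin \o g).
  rewrite (_ : EFin \o g = fun w =>
    (\sum_(i < n) (EFin \o dominator 1 (c i) i) w)%E).
    by apply: integrable_sum => // i _; exact: integrable_dominator.
  by apply/funext => w; rewrite /= sumEFin.
apply: (expectation_cvg measurable_norm_sum_rounded cvg_norm_sum_rounded ig _).2.
move=> k w; rewrite normr_id; apply: le_trans (ler_norm_sum _ _ _) _.
apply: ler_sum => i _.
have t1 : 0 < (1 : R) <= t by rewrite ltr01/=; move: t2; lra.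
have := norm_rounded_le k i w 0; rewrite {1}subr0.
rewrite -/(c i) => /le_trans; apply.
rewrite -[leLHS]powRr1 ?addr_ge0 ?mulr_ge0//.
by apply: powR_dominated; rewrite ?addr_ge0.
Qed.

Lemma rosenthal_finite_moments (p q : R -> R) (lam : nat -> R) (y : 'I_n -> E) :
  admissible p q -> (forall j, (j < mt t)%N -> 0 < lam j) ->
  ('E_P[(fun w => `| `|\sum_(i < n) X i w|
      - fine 'E_P[fun w => `|\sum_(i < n) X i w| ]%R| `^ t)%R] <=
   (Ct t * CA p q lam t *
      (\sum_(i < n) fine 'E_P[fun w => `|X i w - x i| `^ t]%R) +
    CB p q lam t *
      (\sum_(i < n) fine 'E_P[fun w => `|X i w - y i| ^+ 2]%R)
      `^ (t / 2))%:E)%E.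
Proof.
move=> pq lam0.
have t0 : 0 < t by move: t2; lra.
have sq F : (fun w : T => `|F w : E| ^+ 2) = (fun w => `|F w| `^ 2).
  by apply/funext => w; rewrite (powR_mulrn 2).
(* Here [delta] is [1 / (k + 1)], which vanishes in the limit. *)
pose r_ k := Ct t * CA p q lam t *
      (\sum_(i < n) fine ('E_P[fun w => `|Z k i w - x i| `^ t]%R)%E) +
    CB p q lam t *
      (\sum_(i < n) fine ('E_P[fun w => `|Z k i w - y i| ^+ 2]%R)%E + k.+1%:R^-1)
      `^ (t / 2).
apply: (@expectation_fatou _ _ _ _ (fun k w => `| `|\sum_(i < n) Z k i w|
      - fine ('E_P[fun w => `|\sum_(i < n) Z k i w| ]%R)%E| `^ t) _ _ _ r_).
- move=> k; apply: (measurableT_comp (measurable_powR t)).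
  apply: measurableT_comp => //; apply: measurable_funB => //.
  exact: measurable_norm_sum_rounded.
- move=> w; apply: (cvg_norm_powR t0).
  apply: cvgB; first exact: cvg_norm_sum_rounded.
  exact: cvg_mean_rounded.
- by move=> k w; rewrite powR_ge0.
- by move=> k; apply: rounded_bound.
rewrite /r_; apply: cvgD; apply: cvgM; try exact: cvg_cst.
  apply: cvg_sum => i; apply: (cvg_moment _ _ _).2; by rewrite t0 lexx.
set b := \sum_(i < n) _.
have b0 : 0 <= b.
  by apply: sumr_ge0 => i _; rewrite fine_ge0// expectation_ge0.
have tt0 : 0 < t / 2 by rewrite divr_gt0.
have cb : \sum_(i < n) fine ('E_P[fun w => `|Z k i w - y i| ^+ 2]%R)%E + k.+1%:R^-1
    @[k --> \oo] --> b.
  rewrite -[b]addr0; apply: cvgD; last exact: cvg_harmonic.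
  apply: cvg_sum => i; rewrite sq; under eq_fun do rewrite sq.
  by apply: (cvg_moment _ _ _).2; rewrite ltr0n ltW.
have := cvg_norm_powR tt0 cb; rewrite (ger0_norm b0).
under eq_fun => k.
  rewrite ger0_norm; last first.
    rewrite addr_ge0// sumr_ge0// => i _.
    by rewrite fine_ge0// expectation_ge0.
  over.
exact.
Qed.

End finite_moments.

(** * The theorem *)

Section constants_sign.
Variables (R : realType) (t : R) (p q : R -> R) (lam : nat -> R).
Hypothesis t2 : 2 < t.
Hypothesis pq : admissible p q.
Hypothesis lam0 : forall j, (j < mt t)%N -> 0 < lam j.

Lemma cj_gt0 j : (j < mt t)%N -> 0 < cj p q t j.
Proof.
move=> jm; rewrite mulr_gt0//; first exact: (q_gt0 t2 pq jm).
rewrite big_nat_cond prodr_gt0// => k; rewrite andbT => /andP[_ kj].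
by rewrite (cfactor_gt0 t2 pq)// (ltn_trans kj).
Qed.

(** The term [j = 0] is positive. Strictness makes the right-hand side infinite as soon as one
    moment of order [t] is. *)
Lemma CA_gt0 : 0 < CA p q lam t.
Proof.
have t20 : 0 < t - 2 by rewrite subr_gt0.
have m0 := mt_gt0 t2.
rewrite /CA big_ltn// ltr_wpDr//.
  rewrite big_nat_cond sumr_ge0// => j; rewrite andbT => /andP[_ jm].
  apply: mulr_ge0; last by rewrite invr_ge0 mulr_ge0// exprn_ge0// ltW// lam0.
  apply: mulr_ge0; first exact: ltW (cj_gt0 jm).
  by apply: divr_ge0; [rewrite subr_ge0; exact: tj_ge2|exact: ltW].
by rewrite muln0 subr0 fact0 expr0 divff ?gt_eqF// !mulr1 invr1 mulr1 cj_gt0.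
Qed.

Lemma CB_ge0 : 0 <= CB p q lam t.
Proof.
have t20 : 0 < t - 2 by rewrite subr_gt0.
have /andP[tm _] := mt_itv t2; rewrite natrM in tm.
rewrite /CB addr_ge0//.
  rewrite mulr_ge0//.
    rewrite /ctilde big_nat_cond prodr_ge0// => k; rewrite andbT => /andP[_ km].
    by rewrite ltW// (cfactor_gt0 t2 pq).
  by rewrite prodr_ge0// => k _; rewrite invr_ge0 addr_ge0//; lra.
rewrite big_nat_cond sumr_ge0// => j; rewrite andbT => /andP[_ jm].
apply: mulr_ge0; last by rewrite divr_ge0 ?powR_ge0.
by apply: mulr_ge0; [exact: ltW (cj_gt0 jm)|rewrite divr_ge0// ltW].
Qed.

End constants_sign.

(** * Constants for the exponent three *)

Section exponent_three.
Variable R : realType.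

(** Beyond [3] this is the symmetric choice with [w(s)^(1/(3-s)) = 1/2], giving equality in the last
    admissibility condition. *)
Let w (s : R) : R := if s <= 3 then 1 else 2 `^ (s - 3).

Lemma admissible_w : admissible w w.
Proof.
have w2 : w 2 = 1 by rewrite /w ler_nat.
split; rewrite ?w2//; first by rewrite lerDl.
  move=> s _; have h : 1 <= w s.
    rewrite /w; case: (leP s 3) => // s3; rewrite -[leLHS](powRr0 2).
    by rewrite ler_powR ?ler1n// subr_ge0 ltW.
  by split.
move=> s s3; have -> : w s = 2 `^ (s - 3) by rewrite /w leNgt s3.
rewrite -powRrM.
have -> : (s - 3) / (3 - s) = -1.
  by field; rewrite subr_eq0 lt_eqF.
rewrite powR_inv1//; lra.
Qed.

Lemma mt3 : mt (3 : R) = 1%N.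
Proof.
by apply/eqP; rewrite /mt truncn_eq ?divr_ge0//; apply/andP; split; lra.
Qed.

Let w3 : w 3 = 1. Proof. by rewrite /w lexx. Qed.

Lemma CA_three : CA w w (fun=> 1) 3 = 1.
Proof.
rewrite /CA mt3 big_nat1 /cj big_geq// muln0 fact0 subr0 w3.
by field.
Qed.

(** One reduction gives the factor [3], divided by [3/2 - 1 + 1 = 3/2]; the summand [j = 0] carries
    the coefficient [0]. *)
Lemma CB_three : CB w w (fun=> 1) 3 = 2.
Proof.
rewrite /CB /ctilde mt3 !big_nat1 /cj big_geq// /cfactor muln0 fact0 subr0 w3.
by rewrite mul0r mulr0 mul0r addr0; field.
Qed.

End exponent_three.

(** If some moment of order [t] is infinite, the right-hand side is [+oo]; otherwise all
    expectations on the right are finite and the previous bound applies. *)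
Lemma rosenthal_moments (R : realType) (d : measure_display)
    (T : measurableType d) (P : probability T R) (E : completeNormedModType R)
    (n : nat) (X : 'I_n -> T -> E) (t : R) (p q : R -> R) (lam : nat -> R)
    (x y : 'I_n -> E) :
  separable E -> (forall i, random_vector (X i)) -> independent P X ->
  2 < t -> admissible p q -> (forall j, (j < mt t)%N -> 0 < lam j) ->
  ('E_P[(fun w => `| `|\sum_(i < n) X i w|
      - fine 'E_P[fun w => `|\sum_(i < n) X i w| ]%R| `^ t)%R] <=
   (Ct t * CA p q lam t)%:E *
     (\sum_(i < n) 'E_P[(fun w => `|X i w - x i| `^ t)%R]) +
   (CB p q lam t)%:E *
     (\sum_(i < n) 'E_P[(fun w => `|X i w - y i| ^+ 2)%R]) `^ (t / 2))%E.
Proof.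
move=> sepE hX hindep t2 pq lam0.
have E0 i : (0 <= 'E_P[(fun w => `|X i w - x i| `^ t)%R])%E.
  by apply: expectation_ge0 => w; exact: powR_ge0.
have CB0 : (0 <= (CB p q lam t)%:E *
     (\sum_(i < n) 'E_P[(fun w => `|X i w - y i| ^+ 2)%R]) `^ (t / 2))%E.
  by rewrite mule_ge0 ?poweR_ge0// lee_fin CB_ge0.
have Cpos : 0 < Ct t * CA p q lam t.
  by rewrite mulr_gt0 ?(CA_gt0 t2 pq lam0)// (lt_le_trans ltr01)// Ct_ge1.
have [finX|] := pselect (forall i,
    ('E_P[(fun w => `|X i w - x i| `^ t)%R] < +oo)%E); last first.
  move=> /existsNP[i /negP]; rewrite -leNgt leye_eq => /eqP Ei.
  rewrite [X in (_ * X + _)%E](_ : _ = +oo%E); last first.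
    by rewrite (bigD1 i)//= Ei addye// gt_eqF// (lt_le_trans ltNy0)// sume_ge0.
  by rewrite gt0_muley// addye ?leey// gt_eqF// (lt_le_trans ltNy0).
have [e dense_e] := separable_dense_seq sepE.
have := rosenthal_finite_moments hX hindep dense_e t2 finX y pq lam0.
move=> /le_trans; apply; rewrite le_eqVlt; apply/orP; left; apply/eqP.
rewrite EFinD (EFinM (Ct t * CA p q lam t)) (EFinM (CB p q lam t)).
rewrite -poweR_EFin -!sumEFin.
congr (_ * _ + _ * _ `^ _)%E; apply: eq_bigr => i _; rewrite fineK//.
  by rewrite ge0_fin_numE// finX.
rewrite unlock; apply: integrable_fin_num => //.
have t2' : 0 < (2 : R) <= t by rewrite ltr0n ltW.
have [+ _] := cvg_moment hX dense_e finX i (y i) t2'.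
by under eq_fun do rewrite (powR_mulrn 2)//.
Qed.

Theorem corollary4 (R : realType) (d : measure_display) (T : measurableType d)
    (P : probability T R) (E : completeNormedModType R) (hE : separable E)
    (n : nat) (X : 'I_n -> T -> E)
    (hX : forall i, random_vector (X i))
    (hindep : independent P X)
    (Y : T -> R) (hY : Y = fun w => `|\sum_(i < n) X i w|)
    (hYmean : P.-integrable [set: T] (EFin \o Y)) :
  (forall (t : R) (p q : R -> R) (lam : nat -> R) (x y : 'I_n -> E),
     2 < t ->
     admissible p q ->
     (forall j : nat, (j < mt t)%N -> 0 < lam j) ->
     ('E_P[(fun w => `|Y w - fine 'E_P[Y]| `^ t)%R] <=
        (Ct t * CA p q lam t)%:E *
          (\sum_(i < n) 'E_P[(fun w => `|X i w - x i| `^ t)%R]) +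
        (CB p q lam t)%:E *
          (\sum_(i < n) 'E_P[(fun w => `|X i w - y i| ^+ 2)%R]) `^ (t / 2))%E) /\
  (Ct (3 : R) < 1316 / 1000 /\
   forall x y : 'I_n -> E,
     ('E_P[(fun w => `|Y w - fine 'E_P[Y]| ^+ 3)%R] <=
        (1316 / 1000)%:E *
          (\sum_(i < n) 'E_P[(fun w => `|X i w - x i| ^+ 3)%R]) +
        2%:E *
          (\sum_(i < n) 'E_P[(fun w => `|X i w - y i| ^+ 2)%R]) `^ (3 / 2))%E).
Proof.
split=> [t p q lam x y t2 pq lam0|].
  by rewrite hY; exact: rosenthal_moments.
split=> [|x y]; first exact: Ct3_lt.
have t2 : 2 < 3 :> R by rewrite ltr_nat.
(* For [t = 3] only [j = 0] occurs, where [lam] has exponent [0] or coefficient [0]; [1] is a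
   default value. *)
have := rosenthal_moments x y hE hX hindep t2 (admissible_w R)
  (fun j _ => ltr01 : 0 < (fun=> 1) j :> R).
rewrite hY CA_three CB_three mulr1.
have cube (f : T -> R) : (forall w, 0 <= f w) ->
    (fun w => f w `^ 3) = (fun w => f w ^+ 3).
  by move=> f0; apply/funext => w; rewrite (powR_mulrn 3).
rewrite cube// => /le_trans; apply; rewrite leeD2r//.
under eq_bigr do rewrite cube//.
rewrite lee_wpmul2r//.
  by apply: sume_ge0 => i _; apply: expectation_ge0 => w; exact: exprn_ge0.
by rewrite lee_fin ltW// Ct3_lt.
Qed.
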